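(* Let $k$ be an algebraically closed field of characteristic $p>0$ and let $(\mathfrak{g},[p])$ be a finite-dimensional restricted Lie algebra over $k$ such that $V(\mathfrak{g})=\{x\in\mathfrak{g} : x^{[p]}=0\}$ is a subspace of $\mathfrak{g}$ of dimension $\ge 2$. Let $j\in\{1,\ldots,p-1\}$. If $(0)\to N\to E\to M\to(0)$ is a short exact sequence of finite-dimensional $U_0(\mathfrak{g})$-modules of constant $j$-rank with $\mathrm{rk}^j(E)=\mathrm{rk}^j(M)+\mathrm{rk}^j(N)$, then \[ \deg^j(E)=\deg^j(M)+\deg^j(N).\]
   Context: $U_0(\mathfrak{g})=U(\mathfrak{g})/(\{x^p-x^{[p]} : x\in\mathfrak{g}\})$ is the restricted enveloping algebra. For $x\in\mathfrak{g}$, $x_M:M\to M$ is the operator $m\mapsto x.m$. The generic $j$-rank is $\mathrm{rk}^j(M)=\max\{\mathrm{rk}(x_M^j) : x\in V(\mathfrak{g})\}$, and $M$ has constant $j$-rank if $\mathrm{rk}(x_M^j)=\mathrm{rk}(y_M^j)$ for all $x,y\in V(\mathfrak{g})\setminus\{0\}$. Degree of a morphism: if $U\subseteq\mathbb{P}^n$ is non-empty open and $\varphi:U\to\mathbb{P}^m$ is a morphism, there are homogeneous polynomials $f_0,\ldots,f_m\in k[X_0,\ldots,X_n]$ of the same degree $d$ with $\gcd(f_0,\ldots,f_m)=1$ and $\varphi(x)=(f_0(x):\cdots:f_m(x))$ for all $x\in U$; they are unique up to a common non-zero scalar, and $\deg(\varphi):=d$. Degree of a module: let $d_j=\mathrm{rk}^j(M)$.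 The set $U_{M,j}=\{[x]\in\mathbb{P}(V(\mathfrak{g})) : \mathrm{rk}(x_M^j)=d_j\}$ is open, and $\mathrm{im}^j_M:U_{M,j}\to\mathrm{Gr}_{d_j}(M)$, $[x]\mapsto\mathrm{im}\,x_M^j$, is a morphism to the Grassmannian of $d_j$-dimensional subspaces of $M$. Let $\mathrm{pl}_M:\mathrm{Gr}_{d_j}(M)\to\mathbb{P}(\bigwedge^{d_j}M)$ be the Plücker embedding. The $j$-degree is $\deg^j(M):=\deg(\mathrm{pl}_M\circ\mathrm{im}^j_M)$ if $d_j>0$, and $\deg^j(M):=0$ if $d_j=0$. *)

(* Defs.v *)
From HB Require Import structures.
From mathcomp Require Import all_boot all_order all_algebra.
From mathcomp Require Import mpoly.
From mathcomp Require Import boolp classical_sets.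

Set Implicit Arguments.
Unset Strict Implicit.
Unset Printing Implicit Defensive.

Import GRing.Theory.
Local Open Scope ring_scope.
Local Open Scope quotient_scope.

Section RestrictedLieAlgebras.
Variables (k : fieldType) (p : nat).

(* [jacobson_coef br x y n i] is the coefficient of t^i in
   ad(t x + y)^n (x), computed in g ⊗ k[t]. *)
Fixpoint jacobson_coef (g : vectType k) (br : g -> g -> g) (x y : g)
    (n i : nat) : g :=
  if n is n'.+1 then
    (if i is i'.+1 then br x (jacobson_coef br x y n' i') else 0)
    + br y (jacobson_coef br x y n' i)
  else if i is 0%N then x else 0.

(* Jacobson's s_i(x, y): i s_i(x, y) is the coefficient of t^(i-1) in
   ad(t x + y)^(p-1) (x), for 0 < i < p. *)
Definition jacobson_s (g : vectType k) (br : g -> g -> g) (x y : g)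
    (i : nat) : g :=
  i%:R^-1 *: jacobson_coef br x y p.-1 i.-1.

Record restrictedLieAlgebra := RestrictedLieAlgebra {
  rla_sort :> vectType k;
  bracket : rla_sort -> rla_sort -> rla_sort;
  ppow : rla_sort -> rla_sort; (* x |-> x^[p] *)
  rla_pchar : p \in [pchar k];
  bracket_linearl : forall y, linear (bracket ^~ y);
  bracket_linearr : forall x, linear (bracket x);
  bracket_alt : forall x, bracket x x = 0;
  bracket_jacobi : forall x y z,
    bracket x (bracket y z) + bracket y (bracket z x)
    + bracket z (bracket x y) = 0;
  ppow_ad : forall x y, bracket (ppow x) y = iter p (bracket x) y;
  ppowZ : forall (c : k) x, ppow (c *: x) = c ^+ p *: ppow x;
  ppowD : forall x y, ppow (x + y) =
    ppow x + ppow y + \sum_(1 <= i < p) jacobson_s bracket x y i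
}.

End RestrictedLieAlgebras.

(* The restricted enveloping algebra U(g) / (x^p - x^[p]), presented as the
   free unital associative k-algebra on the set g modulo the congruence
   (equivalently, two-sided ideal) generated by the linear relations of g,
   xy - yx = [x, y] and x^p = x^[p]. *)
Section RestrictedEnvelopingAlgebra.
Variables (k : fieldType) (p : nat) (g : restrictedLieAlgebra k p).

Inductive uterm : Type :=
| UGen of g
| UScal of k
| UAdd of uterm & uterm
| UMul of uterm & uterm.

Inductive ueq : uterm -> uterm -> Prop :=
| ueq_refl a : ueq a a
| ueq_sym a b : ueq a b -> ueq b a
| ueq_trans b a c : ueq a b -> ueq b c -> ueq a c
| ueq_add a a' b b' : ueq a a' -> ueq b b' -> ueq (UAdd a b) (UAdd a' b')
| ueq_mul a a' b b' : ueq a a' -> ueq b b' -> ueq (UMul a b) (UMul a' b')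
| ueq_addA a b c : ueq (UAdd a (UAdd b c)) (UAdd (UAdd a b) c)
| ueq_addC a b : ueq (UAdd a b) (UAdd b a)
| ueq_add0 a : ueq (UAdd (UScal 0) a) a
| ueq_addN a : ueq (UAdd (UMul (UScal (-1)) a) a) (UScal 0)
| ueq_mulA a b c : ueq (UMul a (UMul b c)) (UMul (UMul a b) c)
| ueq_mul1 a : ueq (UMul (UScal 1) a) a
| ueq_mulDl a b c : ueq (UMul (UAdd a b) c) (UAdd (UMul a c) (UMul b c))
| ueq_mulDr a b c : ueq (UMul a (UAdd b c)) (UAdd (UMul a b) (UMul a c))
| ueq_scalD c d : ueq (UScal (c + d)) (UAdd (UScal c) (UScal d))
| ueq_scalM c d : ueq (UScal (c * d)) (UMul (UScal c) (UScal d))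
| ueq_scalC c a : ueq (UMul (UScal c) a) (UMul a (UScal c))
| ueq_genP c x y :
    ueq (UGen (c *: x + y)) (UAdd (UMul (UScal c) (UGen x)) (UGen y))
| ueq_bracket x y :
    ueq (UAdd (UGen (bracket x y)) (UMul (UGen y) (UGen x)))
        (UMul (UGen x) (UGen y))
| ueq_ppow x : ueq (iter p (UMul (UGen x)) (UScal 1)) (UGen (ppow x)).

HB.instance Definition _ := gen_eqMixin uterm.
HB.instance Definition _ := gen_choiceMixin uterm.

Definition ueqb : rel uterm := fun a b => `[< ueq a b >].

Fact ueqb_equiv : equiv_class_of ueqb.
Proof.
split=> [a|a b|b a c].
- by apply/asboolP/ueq_refl.
- by apply/asboolP/asboolP; apply: ueq_sym.
- by move=> /asboolP ab /asboolP bc; apply/asboolP/(ueq_trans ab bc).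
Qed.

Canonical ueqb_equivRel := EquivRelPack ueqb_equiv.

Definition U0 := {eq_quot ueqb}.
HB.instance Definition _ := Choice.on U0.
HB.instance Definition _ := EqQuotient.on U0.

Lemma U0_eqP a b : reflect (ueq a b) (\pi_U0 a == \pi_U0 b).
Proof. by rewrite piE; apply: (iffP (asboolP _)). Qed.

Let U0_eq a b : ueq a b -> \pi_U0 a = \pi_U0 b.
Proof. by move/U0_eqP/eqP. Qed.

Let U0W (P : U0 -> Prop) : (forall a, P (\pi_U0 a)) -> forall u, P u.
Proof. by move=> Pa u; rewrite -[u]reprK. Qed.

Let repr_pi a : ueq (repr (\pi_U0 a)) a.
Proof. by apply/U0_eqP; rewrite reprK. Qed.

Definition U0_scal (c : k) : U0 := \pi_U0 (UScal c).
Definition U0_add (u v : U0) : U0 := \pi_U0 (UAdd (repr u) (repr v)).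
Definition U0_mul (u v : U0) : U0 := \pi_U0 (UMul (repr u) (repr v)).
Definition U0_opp (u : U0) : U0 := U0_mul (U0_scal (-1)) u.
Definition U0_scale (c : k) (u : U0) : U0 := U0_mul (U0_scal c) u.

Let piD a b : U0_add (\pi_U0 a) (\pi_U0 b) = \pi_U0 (UAdd a b).
Proof. by apply/U0_eq/ueq_add. Qed.
Let piM a b : U0_mul (\pi_U0 a) (\pi_U0 b) = \pi_U0 (UMul a b).
Proof. by apply/U0_eq/ueq_mul. Qed.

Fact U0_addA : associative U0_add.
Proof.
by elim/U0W=> a; elim/U0W=> b; elim/U0W=> c; rewrite !piD; apply/U0_eq/ueq_addA.
Qed.
Fact U0_addC : commutative U0_add.
Proof. by elim/U0W=> a; elim/U0W=> b; rewrite !piD; apply/U0_eq/ueq_addC. Qed.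
Fact U0_add0 : left_id (U0_scal 0) U0_add.
Proof. by elim/U0W=> a; rewrite piD; apply/U0_eq/ueq_add0. Qed.
Fact U0_addN : left_inverse (U0_scal 0) U0_opp U0_add.
Proof. by elim/U0W=> a; rewrite /U0_opp piM piD; apply/U0_eq/ueq_addN. Qed.
Fact U0_mulA : associative U0_mul.
Proof.
by elim/U0W=> a; elim/U0W=> b; elim/U0W=> c; rewrite !piM; apply/U0_eq/ueq_mulA.
Qed.
Fact U0_mul1 : left_id (U0_scal 1) U0_mul.
Proof. by elim/U0W=> a; rewrite piM; apply/U0_eq/ueq_mul1. Qed.
Fact U0_scalC c u : U0_mul (U0_scal c) u = U0_mul u (U0_scal c).
Proof. by elim/U0W: u => a; rewrite !piM; apply/U0_eq/ueq_scalC. Qed.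
Fact U0_1mul : right_id (U0_scal 1) U0_mul.
Proof. by move=> u; rewrite -U0_scalC U0_mul1. Qed.
Fact U0_mulDl : left_distributive U0_mul U0_add.
Proof.
elim/U0W=> a; elim/U0W=> b; elim/U0W=> c.
by rewrite !(piD, piM); apply/U0_eq/ueq_mulDl.
Qed.
Fact U0_mulDr : right_distributive U0_mul U0_add.
Proof.
elim/U0W=> a; elim/U0W=> b; elim/U0W=> c.
by rewrite !(piD, piM); apply/U0_eq/ueq_mulDr.
Qed.
Fact U0_scalD c d : U0_scal (c + d) = U0_add (U0_scal c) (U0_scal d).
Proof. by rewrite piD; apply/U0_eq/ueq_scalD. Qed.
Fact U0_scalM c d : U0_scal (c * d) = U0_mul (U0_scal c) (U0_scal d).
Proof. by rewrite piM; apply/U0_eq/ueq_scalM. Qed.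

(* The counit, which shows that 1 != 0 in U_0(g). *)
Fixpoint ucounit (a : uterm) : k :=
  match a with
  | UGen _ => 0
  | UScal c => c
  | UAdd a b => ucounit a + ucounit b
  | UMul a b => ucounit a * ucounit b
  end.

Lemma ueq_ucounit a b : ueq a b -> ucounit a = ucounit b.
Proof.
elim=> {a b} //=; try by intros; congruence.
- by move=> a b c; rewrite addrA.
- by move=> a b; rewrite addrC.
- by move=> a; rewrite add0r.
- by move=> a; rewrite mulN1r addNr.
- by move=> a b c; rewrite mulrA.
- by move=> a; rewrite mul1r.
- by move=> a b c; rewrite mulrDl.
- by move=> a b c; rewrite mulrDr.
- by move=> c a; rewrite mulrC.
- by move=> c _ _; rewrite mulr0 addr0.
- by rewrite add0r.
- move=> x; have := prime_gt0 (pcharf_prime (rla_pchar g)).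
  by case: p => //= n _; rewrite mul0r.
Qed.

Fact U0_1neq0 : U0_scal 1 != U0_scal 0.
Proof. by apply/negP => /U0_eqP/ueq_ucounit/eqP; rewrite /= oner_eq0. Qed.

HB.instance Definition _ :=
  GRing.isZmodule.Build U0 U0_addA U0_addC U0_add0 U0_addN.
HB.instance Definition _ := GRing.Zmodule_isNzRing.Build U0
  U0_mulA U0_mul1 U0_1mul U0_mulDl U0_mulDr U0_1neq0.

Fact U0_scaleA c d (u : U0) :
  U0_scale c (U0_scale d u) = U0_scale (c * d) u.
Proof. by rewrite /U0_scale U0_scalM U0_mulA. Qed.
Fact U0_scale1 : left_id 1 U0_scale.
Proof. exact: U0_mul1. Qed.
Fact U0_scaleDr : right_distributive U0_scale +%R.
Proof. by move=> c u v; apply: U0_mulDr. Qed.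
Fact U0_scaleDl (u : U0) : {morph U0_scale^~ u : c d / c + d}.
Proof. by move=> c d; rewrite /U0_scale U0_scalD U0_mulDl. Qed.

HB.instance Definition _ := GRing.Zmodule_isLmodule.Build k U0
  U0_scaleA U0_scale1 U0_scaleDr U0_scaleDl.

Fact U0_scaleAl c (u v : U0) : c *: (u * v) = (c *: u) * v.
Proof. exact: U0_mulA. Qed.
HB.instance Definition _ := GRing.Lmodule_isLalgebra.Build k U0 U0_scaleAl.

Fact U0_scaleAr c (u v : U0) : c *: (u * v) = u * (c *: v).
Proof.
change (U0_mul (U0_scal c) (U0_mul u v) = U0_mul u (U0_mul (U0_scal c) v)).
by rewrite !U0_mulA U0_scalC.
Qed.
HB.instance Definition _ := GRing.Lalgebra_isAlgebra.Build k U0 U0_scaleAr.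

Definition U0_gen (x : g) : U0 := \pi_U0 (UGen x).

Lemma U0_gen_linear : linear U0_gen.
Proof.
move=> c x y; rewrite /U0_gen (U0_eq (ueq_genP c x y)) -piD -piM.
by [].
Qed.

Lemma U0_gen_bracket x y :
  U0_gen (bracket x y) = U0_gen x * U0_gen y - U0_gen y * U0_gen x.
Proof.
apply/eqP; rewrite eq_sym subr_eq; apply/eqP.
by rewrite [LHS]piM -(U0_eq (ueq_bracket x y)) -piD -piM.
Qed.

Lemma U0_gen_ppow x : U0_gen (ppow x) = U0_gen x ^+ p.
Proof.
rewrite /U0_gen -(U0_eq (ueq_ppow x)).
by elim: p => //= n IHn; rewrite -piM IHn exprS.
Qed.

End RestrictedEnvelopingAlgebra.

Section U0Modules.
Variables (k : fieldType) (p : nat) (g : restrictedLieAlgebra k p).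

Record U0module := U0Module {
  umod_sort :> vectType k;
  uact : U0 g -> 'End(umod_sort);
  uact_linear : linear uact;
  uact1 : uact 1 = \1%VF;
  uactM : forall u v, uact (u * v) = (uact u \o uact v)%VF
}.

Definition U0_equivariant (M N : U0module) (f : 'Hom(M, N)) :=
  forall (u : U0 g) (m : M), f (uact M u m) = uact N u (f m).

Definition short_exact (N E M : U0module) (i : 'Hom(N, E)) (q : 'Hom(E, M)) :=
  [/\ U0_equivariant i, U0_equivariant q,
      lker i = 0%VS, limg i = lker q & limg q = fullv].

(* [xpow M x j] is the operator x_M^j. *)
Definition xpow (M : U0module) (x : g) (j : nat) : 'End(M) :=
  iter j (comp_lfun (uact M (U0_gen x))) \1%VF.

Definition xrank (M : U0module) (x : g) (j : nat) : nat :=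
  \dim (limg (xpow M x j)).

Definition generic_rank (M : U0module) (j : nat) : nat :=
  \max_(d < (\dim {:M}).+1 | `[< exists2 x : g, ppow x = 0 & xrank M x j = d >])
    d.

Definition constant_rank (M : U0module) (j : nat) :=
  forall x y : g, ppow x = 0 -> x != 0 -> ppow y = 0 -> y != 0 ->
    xrank M x j = xrank M y j.

End U0Modules.

Section Grassmannians.
Variable k : fieldType.

Definition Gr (d : nat) (W : vectType k) := {L : {vspace W} | \dim L == d}.
Definition Proj (W : vectType k) := Gr 1 W.

(* The exterior power of W in coordinates: it has basis
   e_I = e_{i_1} /\ ... /\ e_{i_d}, I = {i_1 < ... < i_d}, where e is
   the basis [vbasis {:W}] of W. *)
Definition Ext (d : nat) (W : vectType k) :=
  {ffun {I : {set 'I_(\dim {:W})} | #|I| == d} -> k^o}.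

Definition subset_nth (d n : nat) (I : {I : {set 'I_n} | #|I| == d})
    (b : 'I_d) : 'I_n :=
  enum_val (cast_ord (esym (eqP (valP I))) b).

(* w_0 /\ ... /\ w_{d-1}, whose coordinate at e_I is a d x d minor. *)
Definition wedge (d : nat) (W : vectType k) (w : 'I_d -> W) : Ext d W :=
  [ffun I => \det (\matrix_(a < d, b < d)
                     coord (vbasis {:W}) (subset_nth I b) (w a) : 'M[k]_d)].

Definition pl_vect (d : nat) (W : vectType k) (L : Gr d W) : Ext d W :=
  wedge (fun a : 'I_d => (vbasis (val L))`_a).

Fact pl_subproof (d : nat) (W : vectType k) (L : Gr d W) :
  \dim <[pl_vect L]>%VS == 1%N.
Proof.
rewrite dim_vline eqb1; set e := vbasis {:W}.
have dL : \dim (val L) = d by apply/eqP/(valP L).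
pose w (a : 'I_d) : W := (vbasis (val L))`_a.
pose A := \matrix_(i < \dim {:W}, a < d) coord e i (w a).
have fullA : row_full A.
  rewrite /row_full -mxrank_tr; apply: (@inj_row_free _ _ _ A^T) => u uA0.
  have /freeP wfree := basis_free (vbasisP (val L)).
  suff uw0 : \sum_(a < d) u 0 a *: w a = 0.
    apply/rowP => a; rewrite mxE -[a](cast_ordKV dL).
    apply: (wfree (fun a => u 0 (cast_ord dL a))).
    rewrite -[RHS]uw0 [RHS](reindex (cast_ord dL)) //=.
    by exists (cast_ord (esym dL)) => ? _; rewrite ?cast_ordK ?cast_ordKV.
  rewrite (coord_vbasis (memvf (\sum_a _))) big1 // => i _.
  rewrite linear_sum /= -/e -[RHS](scale0r e`_i); congr (_ *: _).
  have /rowP/(_ i) := uA0; rewrite !mxE => uA0i; rewrite -[RHS]uA0i.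
  by apply: eq_bigr => a _; rewrite !mxE linearZ.
pose f := fullrankfun fullA.
pose I := [set f a | a : 'I_d].
have cI : #|I| == d by rewrite card_imset ?card_ord //; apply: fullrankfun_inj.
pose J : {I : {set 'I_(\dim {:W})} | #|I| == d} := Sub I cI.
pose B : 'M[k]_d := \matrix_(a, b) coord e (subset_nth J b) (w a).
suff : B^T \in unitmx.
  rewrite unitmx_tr unitmxE unitfE; apply: contra_neq => /ffunP/(_ J).
  by rewrite !ffunE.
have f1 : (1%:M <= rowsub f A)%MS by rewrite sub1mx fullrowsub_full.
rewrite -row_full_unit -sub1mx; apply/(submx_trans f1)/row_subP => a.
have faI : f a \in val J by apply: imset_f.
pose b := cast_ord (eqP (valP J)) (enum_rank_in faI (f a)).
suff -> : row a (rowsub f A) = row b B^T by apply: row_sub.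
apply/rowP => c; rewrite !mxE /subset_nth.
by rewrite /b cast_ordK enum_rankK_in.
Qed.

Definition pl (d : nat) (W : vectType k) (L : Gr d W) : Proj (Ext d W) :=
  Sub <[pl_vect L]>%VS (pl_subproof L).

End Grassmannians.

Section Degree.
Variable k : fieldType.

(* phi is given on U by the coordinates (f_0 : ... : f_m), and these are
   homogeneous of degree d with gcd 1; coordinates on A and B are those of
   [vbasis {:A}] and [vbasis {:B}]. *)
Definition has_degree (A B : vectType k) (U : pred (Proj A))
    (phi : {L : Proj A | U L} -> Proj B) (d : nat) : Prop :=
  exists f : 'I_(\dim {:B}) -> {mpoly k[\dim {:A}]},
    [/\ forall i, f i \is d.-homog,
        forall h : {mpoly k[\dim {:A}]},
          (forall i, exists q, f i = q * h) -> h \is a GRing.unit &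
        forall (L : {L : Proj A | U L}) (x : A),
          x \in val (val L) -> x != 0 ->
          val (phi L) =
          <[\sum_i (f i).@[fun a => coord (vbasis {:A}) a x]
                     *: (vbasis {:B})`_i]>%VS].

(* For a morphism phi there is exactly one such d; 0 is a junk value. *)
Definition degree (A B : vectType k) (U : pred (Proj A))
    (phi : {L : Proj A | U L} -> Proj B) : nat :=
  xget 0%N (has_degree phi).

End Degree.

Section ModuleDegree.
Variables (k : fieldType) (p : nat) (g : restrictedLieAlgebra k p).
(* V is meant to be the null cone V(g), assumed to be a subspace of g. *)
Variables (V : {vspace g}) (M : U0module g) (j : nat).

(* A nonzero x in V with L = [x]; neither the rank nor the image of x_M^j
   depends on its choice. *)
Definition line_repr (L : Proj (subvs_of V)) : g := vsval (vpick (val L)).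

Definition UMj : pred (Proj (subvs_of V)) :=
  fun L => xrank M (line_repr L) j == generic_rank M j.

Definition imj (L : {L | UMj L}) : Gr (generic_rank M j) M :=
  Sub (limg (xpow M (line_repr (val L)) j)) (valP L).

Definition jdegree : nat :=
  if (0 < generic_rank M j)%N then degree (fun L => pl (imj L)) else 0%N.

End ModuleDegree.

(* Main.v *)
(** Minors of x^j give the Plücker coordinates of im x^j as homogeneous
    polynomials. For a spanning family z of a module of constant j-rank d, the
    minor of x^j with columns c and rows I factors as v_c F_I with F_I of gcd 1
    (k[X_1,...,X_n] is factorial); constancy of the rank makes both F and v
    vanish nowhere off the origin, so F computes deg^j and
    deg v = j d - deg^j. Up to a scalar depending on x only, v_c(x) is the
    determinant of the vectors x^j z_(c a) in a basis of im x^j. When ranks add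
    up, 0 -> im x_N^j -> im x_E^j -> im x_M^j -> 0 is exact for every x, so for
    a spanning family of E adapted to N these determinants are block triangular
    and v_E restricts, up to a scalar, to v_M v_N. Two pointwise
    proportional nowhere vanishing families in at least two variables have the
    same degree, hence deg v_E = deg v_M + deg v_N. *)

Require Import Defs.
From HB Require Import structures.
From mathcomp Require Import all_boot all_order all_algebra perm.
From mathcomp Require Import mpoly.
From mathcomp Require Import boolp classical_sets.

Set Implicit Arguments.
Unset Strict Implicit.
Unset Printing Implicit Defensive.

Import GRing.Theory.
Local Open Scope ring_scope.

(** * Unique factorization *)

Section Divisibility.
Variable R : idomainType.
Implicit Types (a b x y : R) (s : seq R).

Definition divides a b := exists c, b = c * a.

Definition prime_elt x :=
  [/\ x != 0, x \isn't a GRing.unit &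
      forall a b, divides x (a * b) -> divides x a \/ divides x b].

Definition factors a :=
  exists u s, [/\ u \is a GRing.unit, {in s, forall x, prime_elt x}
               & a = u * \prod_(x <- s) x].

Lemma divides_mull a b c : divides a b -> divides a (c * b).
Proof. by case=> d ->; exists (c * d); rewrite mulrA. Qed.

Lemma divides_mulr a b c : divides a b -> divides a (b * c).
Proof. by rewrite mulrC; apply: divides_mull. Qed.

Lemma dividesD a b c : divides a b -> divides a c -> divides a (b + c).
Proof. by move=> [d ->] [e ->]; exists (d + e); rewrite mulrDl. Qed.

Lemma dividesDr a b c : divides a b -> divides a (b + c) -> divides a c.
Proof.
move=> [d ->] [e e_eq]; exists (e - d).
by rewrite mulrBl -e_eq addrC addKr.
Qed.

Lemma factors_unit u : u \is a GRing.unit -> factors u.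
Proof. by move=> uu; exists u, [::]; rewrite big_nil mulr1. Qed.

Lemma factors_prime x : prime_elt x -> factors x.
Proof.
move=> px; exists 1, [:: x]; split; rewrite ?unitr1 ?big_seq1 ?mul1r //.
by move=> y; rewrite inE => /eqP->.
Qed.

Lemma factorsM a b : factors a -> factors b -> factors (a * b).
Proof.
move=> [u [s [uu ps ->]]] [v [t [uv pt ->]]].
exists (u * v), (s ++ t); split; first by rewrite unitrM uu.
  by move=> x; rewrite mem_cat => /orP[/ps|/pt].
by rewrite big_cat /= mulrACA.
Qed.

Lemma factors_prod (T : eqType) (r : seq T) (F : T -> R) :
  {in r, forall t, factors (F t)} -> factors (\prod_(t <- r) F t).
Proof.
elim: r => [|t r IHr] Fr.
  by rewrite big_nil; apply/factors_unit/unitr1.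
rewrite big_cons; apply: factorsM; first by apply: Fr; rewrite mem_head.
by apply: IHr => z zr; apply: Fr; rewrite inE zr orbT.
Qed.

Lemma prime_divides_prod x u s : prime_elt x -> u \is a GRing.unit ->
  divides x (u * \prod_(y <- s) y) -> exists2 y, y \in s & divides x y.
Proof.
move=> [x0 xu px] uu; elim: s => [|y s IHs].
  rewrite big_nil mulr1 => -[c ucx]; case/negP: xu.
  by move: uu; rewrite ucx unitrM => /andP[].
rewrite big_cons mulrCA => /px[xy|/IHs[z zs xz]]; first by exists y; rewrite ?mem_head.
by exists z; rewrite // inE zs orbT.
Qed.

(** Primes are irreducible: [c * x] divides one of its own two factors. Dividing [c] would make [x]
    a unit, and dividing [x] makes [c] one. *)
Lemma prime_divides_prime c x :
  prime_elt x -> prime_elt (c * x) -> c \is a GRing.unit.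
Proof.
move=> [x0 xu _] [y0 _ py].
have [|[d dE]|[d dE]] := py c x; first by exists 1; rewrite mul1r.
  have c0 : c != 0 by apply: contraNneq y0 => ->; rewrite mul0r.
  have dx1 : d * x = 1 by apply: (mulfI c0); rewrite mulr1 [RHS]dE mulrCA.
  by case/negP: xu; apply/unitrP; exists d; rewrite [x * d]mulrC.
have dc1 : d * c = 1 by apply: (mulIf x0); rewrite mul1r [RHS]dE mulrA.
by apply/unitrP; exists d; rewrite [c * d]mulrC.
Qed.

Lemma factorization_neq0 u s : u \is a GRing.unit ->
  {in s, forall x, prime_elt x} -> u * \prod_(x <- s) x != 0.
Proof.
move=> uu ps; rewrite mulf_neq0 //.
  by apply: contraTneq uu => ->; rewrite unitr0.
by rewrite prodf_seq_neq0; apply/allP => x xs; rewrite implyTb; have [] := ps x xs.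
Qed.

(* Weaker than "no prime divides all the [f i]", but enough for
   [coprime_family_proportional]. *)
Definition coprime_family (I : Type) (f : I -> R) := exists i u s,
  [/\ u \is a GRing.unit, {in s, forall x, prime_elt x},
      f i = u * \prod_(x <- s) x &
      {in s, forall x, exists j, ~ divides x (f j)}].

(** It is enough that [f i] divides [r i] for the factored member [f i]. A prime [x] of [f i] fails
    to divide some [f j], so [f i * r j = f j * r i] forces it to divide [r i]. The primes are
    cancelled one at a time. *)
Lemma coprime_family_proportional (I : Type) (f r : I -> R) :
    coprime_family f -> (forall i j, f i * r j = f j * r i) ->
  exists c, forall i, r i = c * f i.
Proof.
move=> cf fr; have [i [u [s [uu ps fi nds]]]] := cf.
have fi0 : f i != 0.
  by rewrite fi; apply: factorization_neq0.
suff [c rc] : divides (f i) (r i).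
  exists c => j; apply: (mulfI fi0).
  by rewrite fr rc [RHS]mulrA mulrC [f i * c]mulrC.
(* The induction shrinks [f i] and [r i] together while every [f j] and [r j] in the cross relations
   stays fixed, so [r i] becomes a variable. *)
move: fi (r i) (fr i) => -> {fi0 fr}.
elim: s ps nds => [|x s IHs] ps nds b frb.
  by rewrite big_nil mulr1; exists (b / u); rewrite divrK.
have [x0 _ px] := ps x (mem_head _ _).
have [j ndj] := nds x (mem_head _ _).
have [//|[b' bE]] : divides x (f j) \/ divides x b.
  apply: px; rewrite -frb big_cons; apply: divides_mulr.
  by rewrite mulrCA; exists (u * \prod_(y <- s) y); rewrite mulrC.
have [|||c cE] := IHs _ _ b'.
- by move=> y ys; apply: ps; rewrite inE ys orbT.
- by move=> y ys; apply: nds; rewrite inE ys orbT.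
- move=> l; apply: (mulfI x0); move: (frb l); rewrite big_cons bE => e.
  by rewrite mulrA [x * (u * _)]mulrCA e mulrA mulrC.
by exists c; rewrite bE cE big_cons -!mulrA [x * _]mulrC.
Qed.

(** This extracts a common divisor [h] with coprime quotients. A prime of [f i] that divides the
    whole family is moved into [h], which shortens the factorization of [f i]; when there is none
    left, the family is coprime. *)
Lemma factors_coprime_family (I : Type) (f : I -> R) i :
    factors (f i) ->
  exists h f', [/\ h != 0, coprime_family f' & forall j, f j = h * f' j].
Proof.
case=> u [s]; move: {2}(size s) (leqnn (size s)) => n.
elim: n s f => [|n IHn] s f.
  rewrite leqn0 size_eq0 => /eqP-> [uu ps fi]; exists 1, f; split.
  - exact: oner_neq0.
  - by exists i, u, [::].
  - by move=> j; rewrite mul1r.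
move=> sn [uu ps fi].
have [[x xs xf]|nx] := pselect (exists2 x, x \in s & forall j, divides x (f j)).
  have /choice[f' f'E] := xf.
  have [x0 _ _] := ps x xs.
  have [||h [f'' [h0 cf hf]]] := IHn (rem x s) f'.
  - by rewrite size_rem // -subn1 leq_subLR add1n.
  - split=> //; first by move=> y /mem_rem/ps.
    apply: (mulIf x0); rewrite -f'E fi (perm_big _ (perm_to_rem xs)) big_cons /=.
    by rewrite -mulrA [_ * x]mulrC.
  exists (x * h), f''; split; rewrite ?mulf_neq0 // => j.
  by rewrite f'E hf mulrC mulrA.
exists 1, f; split; rewrite ?oner_neq0 //; last by move=> j; rewrite mul1r.
exists i, u, s; split=> // x xs; apply/existsNP => xf; apply: nx; exists x => //.
Qed.

End Divisibility.

Definition factorial_ring (R : idomainType) := forall a : R, a != 0 -> factors a.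

(** * Gauss's lemma: polynomials over a factorial ring *)

Section Gauss.
Variable R : idomainType.
Hypothesis facR : factorial_ring R.
Implicit Types (f g q r : {poly R}) (x a : R).

Lemma divides_polyCP x f : divides x%:P f <-> forall i, divides x f`_i.
Proof.
split=> [[q ->] i|/choice[q qE]].
  by rewrite coefMC; exists q`_i.
exists (\poly_(i < size f) q i); apply/polyP => i.
rewrite coefMC coef_poly; case: ltnP => [_|/(nth_default 0) ->]; first exact: qE.
by rewrite mul0r.
Qed.

Lemma divides_polyC_mulX x f : divides x%:P (f * 'X) -> divides x%:P f.
Proof.
by move=> /divides_polyCP xf; apply/divides_polyCP => i; have := xf i.+1; rewrite coefMX.
Qed.

Lemma divides_polyC x a : divides x a -> divides x%:P a%:P.
Proof. by case=> c ->; exists c%:P; rewrite polyCM. Qed.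

(** Double induction on the two polynomials. The constant term of the product is [c * d], so [x]
    divides [c] or [d]. That constant term can then be dropped from its factor, and cancelling ['X]
    leads to a smaller pair. *)
Lemma prime_polyC x : prime_elt x -> prime_elt x%:P.
Proof.
move=> [x0 xu px]; split; rewrite ?polyC_eq0 //.
  by apply: contra xu => /andP[]; rewrite coefC eqxx.
elim/poly_ind=> [|f c IHf] g; first by left; exists 0; rewrite mul0r.
elim/poly_ind: g => [|g d IHg]; first by right; exists 0; rewrite mul0r.
move=> xfg; have [xc|xd] : divides x c \/ divides x d.
- apply: px; have := (divides_polyCP _ _).1 xfg 0%N.
  by rewrite coef0M !(coefD, coefMX, coefC) /= !add0r.
- have xc' := divides_polyC xc.
  have [|xf|] := IHf (g * 'X + d%:P); last by right.
    apply: divides_polyC_mulX; rewrite mulrAC.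
    by move: xfg; rewrite mulrDl addrC; apply/dividesDr/divides_mulr.
  by left; apply: dividesD => //; apply: divides_mulr.
- have xd' := divides_polyC xd.
  have [||xg] := IHg; last 2 first; first by left.
    by right; apply: dividesD => //; apply: divides_mulr.
  apply: divides_polyC_mulX; rewrite -mulrA.
  by move: xfg; rewrite mulrDr addrC; apply/dividesDr/divides_mull.
Qed.

Definition primitive f := forall x, prime_elt x -> ~ divides x%:P f.

(** Induction on the number of primes of the leading coefficient. A prime constant dividing [f] is
    associated to one of them, so dividing it out leaves one fewer. Once none is left, the leading
    coefficient is a unit and [f] is primitive. *)
Lemma polyC_content f : f != 0 ->
  exists a f', [/\ a != 0, f' != 0, primitive f' & f = a%:P * f'].
Proof.
move=> f0; have lf0 : lead_coef f != 0 by rewrite lead_coef_eq0.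
have {lf0} [u [s [uu ps lf]]] := facR lf0.
move: {2}(size s) (leqnn (size s)) => n.
elim: n u s f f0 uu ps lf => [|n IHn] u s f f0 uu ps lf sn; last first.
  have [[x px [f1 fE]]|nx] := pselect (exists2 x, prime_elt x & divides x%:P f).
    have [x0 _ _] := px.
    have lfE : lead_coef f = lead_coef f1 * x by rewrite fE lead_coefM lead_coefC.
    have [|y ys [c yE]] := prime_divides_prod (s := s) px uu.
      by rewrite -lf lfE; exists (lead_coef f1).
    have uc : c \is a GRing.unit.
      by apply: (prime_divides_prime px); rewrite -yE; apply: ps.
    have [|||||a [f' [a0 f'0 pf fE']]] := IHn (u * c) (rem y s) f1.
    - by apply: contraNneq f0 => f10; rewrite fE f10 mul0r.
    - by rewrite unitrM uu.
    - by move=> z /mem_rem/ps.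
    - apply: (mulIf x0); rewrite -lfE lf (perm_big _ (perm_to_rem ys)) big_cons /=.
      by rewrite yE -!mulrA; congr (_ * _); congr (_ * _); rewrite mulrC.
    - by rewrite size_rem // -subn1 leq_subLR add1n.
    exists (x * a), f'; split; rewrite ?mulf_neq0 //.
    by rewrite fE fE' polyCM mulrC mulrA.
  exists 1, f; split; rewrite ?oner_neq0 ?mul1r // => x px xf.
  by apply: nx; exists x.
move: sn lf; rewrite leqn0 size_eq0 => /eqP->; rewrite big_nil mulr1 => lf.
exists 1, f; split; rewrite ?oner_neq0 ?mul1r // => x [_ xu _] [f1 fE].
case/negP: xu; move: uu; rewrite -lf fE lead_coefM lead_coefC unitrM.
by case/andP.
Qed.

(** Each prime of [a] divides [q * f] but not the primitive [f], so it divides [q] and cancels. *)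
Lemma primitive_divides a f g q : a != 0 -> primitive f ->
  a%:P * g = q * f -> divides f g.
Proof.
move=> a0 pf; have [u [s [uu ps ->]]] := facR a0 => {a a0}.
elim: s ps q => [|x s IHs] ps q.
  rewrite big_nil mulr1 => e; exists (u^-1%:P * q).
  by rewrite -mulrA -e mulrA -polyCM mulVr // mul1r.
have px := ps x (mem_head _ _).
have [x0 _ _] := px; have [_ _ ppx] := prime_polyC px.
rewrite big_cons => e.
have [[q' q'E]|/(pf _ px)//] : divides x%:P q \/ divides x%:P f.
  apply: ppx; rewrite -e mulrCA polyCM -mulrA mulrC.
  by exists ((u * \prod_(y <- s) y)%:P * g).
apply: (IHs _ q') => [y ys|]; first by apply: ps; rewrite inE ys orbT.
apply: (mulfI (_ : x%:P != 0)); first by rewrite polyC_eq0.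
by rewrite !mulrA -polyCM mulrCA e q'E [x%:P * q']mulrC.
Qed.

(** Clears denominators: each prime of [a] stays prime among polynomials, hence divides [q] or [r]
    and is cancelled there without changing the size. *)
Lemma polyC_mul_split a f q r : a != 0 -> a%:P * f = q * r ->
  exists q' r', [/\ f = q' * r', size q' = size q & size r' = size r].
Proof.
move=> a0; have [u [s [uu ps ->]]] := facR a0 => {a a0}.
elim: s ps q r => [|x s IHs] ps q r.
  rewrite big_nil mulr1 => e; exists (u^-1 *: q), r; split=> //.
    by rewrite -scalerAl -e mul_polyC scalerA mulVr // scale1r.
  by rewrite size_scale // invr_eq0; apply: contraTneq uu => ->; rewrite unitr0.
have px := ps x (mem_head _ _).
have [x0 _ _] := px; have [xP0 _ ppx] := prime_polyC px.
rewrite big_cons mulrCA polyCM -mulrA => e.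
have szx t : size (t * x%:P) = size t by rewrite mulrC mul_polyC size_scale.
have {}IHs : forall q r, (u * \prod_(y <- s) y)%:P * f = q * r ->
    exists q' r', [/\ f = q' * r', size q' = size q & size r' = size r].
  by apply: IHs => y ys; apply: ps; rewrite inE ys orbT.
have [|[t tE]|[t tE]] := ppx q r.
- by rewrite -e mulrC; exists ((u * \prod_(y <- s) y)%:P * f).
- have [|q' [r' [fE sq sr]]] := IHs t r.
    by apply: (mulfI xP0); rewrite e tE mulrA [x%:P * t]mulrC.
  by exists q', r'; rewrite tE szx.
- have [|q' [r' [fE sq sr]]] := IHs q t.
    by apply: (mulfI xP0); rewrite e tE [RHS]mulrCA [x%:P * t]mulrC.
  by exists q', r'; rewrite tE szx.
Qed.

(** Over the fraction field [f] is irreducible, hence prime by the Euclidean gcd. Primitivity brings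
    the divisibility back to [R]. *)
Lemma irreducible_primitive_prime f : (1 < size f)%N -> primitive f ->
  (forall q r, f = q * r -> (size q <= 1)%N \/ (size r <= 1)%N) -> prime_elt f.
Proof.
move=> sf pf irr.
have f0 : f != 0 by rewrite -size_poly_gt0 ltnW.
(* Over a domain, [%|] and [%=] are taken up to nonzero constants, so this is irreducibility over
   the fraction field. *)
have fP q : q %| f -> size q != 1%N -> q %= f.
  move=> qf sq; case/Pdiv.WeakIdomain.dvdpP: (qf) => -[a r] /= a0.
  rewrite -mul_polyC => e.
  have [q' [r' [fE sq' sr']]] := polyC_mul_split a0 e.
  have r'0 : r' != 0 by apply: contraNneq f0 => z; rewrite fE z mulr0.
  have q'0 : q' != 0 by apply: contraNneq f0 => z; rewrite fE z mul0r.
  have [sz|sz] := irr _ _ fE; last first.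
    by case/eqP: sq; apply/eqP; rewrite eqn_leq -sr' sz lt0n size_poly_eq0.
  rewrite -(dvdp_size_eqp qf) fE size_mul // sr'.
  have -> : size q' = 1%N by apply/eqP; rewrite eqn_leq sz lt0n size_poly_eq0.
  by rewrite add1n.
split=> //.
  by apply/negP => /andP[/eqP sf1]; rewrite sf1 in sf.
move=> g h [c fgh].
have {fgh} fgh : f %| g * h by rewrite fgh dvdp_mull.
suff [] : f %| g \/ f %| h.
- case/Pdiv.WeakIdomain.dvdpP=> -[a q] /= a0; rewrite -mul_polyC => e.
  by left; apply: primitive_divides e.
- case/Pdiv.WeakIdomain.dvdpP=> -[a q] /= a0; rewrite -mul_polyC => e.
  by right; apply: primitive_divides e.
have [cfg|ncfg] := boolP (coprimep f g); first by right; rewrite -(Gauss_dvdpr _ cfg).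
left; have /eqp_dvdl <- := fP _ (dvdp_gcdl f g) ncfg.
exact: dvdp_gcdr.
Qed.

(** Induction on the size. After the content is split off, a primitive polynomial is constant, or a
    product of two shorter nonconstant ones, or prime. *)
Lemma poly_factorial : factorial_ring {poly R}.
Proof.
move=> f; have [n] := ubnP (size f); elim: n f => // n IHn f.
rewrite ltnS => sfn f0; have [a [f' [a0 f'0 pf fE]]] := polyC_content f0.
rewrite fE; have fC (c : R) : c != 0 -> factors c%:P.
  move=> c0; have [u [s [uu ps ->]]] := facR c0.
  rewrite polyCM rmorph_prod; apply: factorsM; last first.
    by apply: factors_prod => x /ps/prime_polyC/factors_prime.
  exact/factors_unit/(rmorph_unit (@polyC R)).
apply: factorsM; first exact: fC.
have sf : size f' = size f by rewrite fE mul_polyC size_scale.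
have [sf1|sf1] := leqP (size f') 1.
  rewrite (size1_polyC sf1); apply: fC; rewrite -polyC_eq0 -size1_polyC //.
have [[g [h [gh sg sh]]]|irr] :=
  pselect (exists g h, [/\ f' = g * h, (1 < size g)%N & (1 < size h)%N]).
  have g0 : g != 0 by rewrite -size_poly_gt0 ltnW.
  have h0 : h != 0 by rewrite -size_poly_gt0 ltnW.
  move: sfn; rewrite -sf gh size_mul // => sfn.
  apply: factorsM; apply: IHn => //; apply: leq_trans sfn.
    by rewrite -subn1 ltn_subRL addnC ltn_add2l.
  by rewrite -subn1 ltn_subRL ltn_add2r.
apply/factors_prime/irreducible_primitive_prime => // q r qr.
have [|sq] := leqP (size q) 1; first by left.
have [|sr] := leqP (size r) 1; first by right.
by case: irr; exists q, r.
Qed.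

End Gauss.

Lemma can_factorial (R S : idomainType) (phi : R -> S) (psi : S -> R) :
    cancel phi psi -> cancel psi phi ->
    {morph phi : x y / x * y} -> phi 1 = 1 ->
    {morph psi : x y / x * y} -> psi 1 = 1 -> psi 0 = 0 ->
  factorial_ring S -> factorial_ring R.
Proof.
move=> phiK psiK phiM phi1 psiM psi1 psi0 facS a a0.
have [u [s [uu ps sE]]] : factors (phi a).
  by apply: facS; apply: contraNneq a0 => e; rewrite -[a]phiK e psi0.
rewrite -[a]phiK sE psiM (big_morph psi psiM psi1); apply: factorsM.
  apply/factors_unit/unitrP; exists (psi u^-1).
  by rewrite -!psiM mulVr // mulrV.
apply: factors_prod => x /ps[x0 xu px]; apply: factors_prime; split.
- by apply: contraNneq x0 => e; rewrite -[x]psiK e -psi0 psiK.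
- apply: contra xu => /unitrP[y [yx xy]]; apply/unitrP; exists (phi y).
  by rewrite -[x]psiK -!phiM yx xy.
- move=> b c [d bcd]; have [] := px (phi b) (phi c).
  + by exists (phi d); rewrite -phiM bcd phiM psiK.
  + by case=> e be; left; exists (psi e); rewrite -psiM -be phiK.
  + by case=> e be; right; exists (psi e); rewrite -psiM -be phiK.
Qed.

(** * Factoriality of polynomial rings in several variables over a field *)

Section MPolyFactorial.
Variable F : fieldType.

(** The inverse of [muni], which singles out the last variable; the two identify the ring in [n.+1]
    variables with polynomials over the ring in [n] variables. *)
Definition poly_to_mpoly n (p : {poly {mpoly F[n]}}) : {mpoly F[n.+1]} :=
  (horner_eval 'X_ord_max \o map_poly (@mwiden n F)) p.

Lemma poly_to_mpoly0 n : @poly_to_mpoly n 0 = 0.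
Proof. exact: rmorph0. Qed.

Lemma poly_to_mpoly1 n : @poly_to_mpoly n 1 = 1.
Proof. exact: rmorph1. Qed.

Lemma poly_to_mpolyD n : {morph @poly_to_mpoly n : p q / p + q}.
Proof. exact: rmorphD. Qed.

Lemma poly_to_mpolyM n : {morph @poly_to_mpoly n : p q / p * q}.
Proof. exact: rmorphM. Qed.

Lemma poly_to_mpolyC n (c : {mpoly F[n]}) : poly_to_mpoly c%:P = mwiden c.
Proof. by rewrite /poly_to_mpoly /= map_polyC /horner_eval hornerC. Qed.

Lemma poly_to_mpolyXn n e : @poly_to_mpoly n 'X^e = 'X_ord_max ^+ e.
Proof. by rewrite /poly_to_mpoly /= map_polyXn /horner_eval hornerXn. Qed.

Lemma muni_X n (m : 'X_{1..n.+1}) : muni 'X_[F, m] =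
  'X_[[multinom (m (widen_ord (leqnSn n) i)) | i < n]] *: 'X^(m ord_max).
Proof. by rewrite muniE msuppX big_seq1 mcoeffX eqxx scale1r. Qed.

Lemma poly_to_mpolyK n : cancel (@poly_to_mpoly n) (@muni n F).
Proof.
elim/poly_ind=> [|p c IHp]; first by rewrite poly_to_mpoly0 muni0.
rewrite poly_to_mpolyD poly_to_mpolyM muniD muniM IHp; congr (_ * _ + _).
  rewrite -['X]expr1 poly_to_mpolyXn expr1 muni_X mnm1E eqxx expr1 -mul_polyC.
  set m := [multinom _ | _ < _].
  suff -> : m = 0%MM by rewrite mpolyX0 mul1r.
  apply/mnmP => l; rewrite mnmE mnm1E mnm0E; case: eqP => // /(congr1 val) /= e.
  by have := ltn_ord l; rewrite -e ltnn.
rewrite poly_to_mpolyC.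
elim/mpolyind: c => [|c m q _ _ IHq]; first by rewrite mwiden0 muni0.
rewrite mwidenD muniD polyCD -IHq; congr (_ + _).
rewrite mwidenZ muniZ mwidenX muni_X mnmwiden_ordmax expr0.
rewrite scalerA mul_mpolyC alg_polyC; congr (_ *: 'X_[_])%:P.
by apply/mnmP => l; rewrite mnmE mnmwiden_widen.
Qed.

Lemma muniK n : cancel (@muni n F) (@poly_to_mpoly n).
Proof.
elim/mpolyind=> [|c m p _ _ IHp]; first by rewrite muni0 poly_to_mpoly0.
rewrite muniD poly_to_mpolyD [X in _ + X = _]IHp; congr (_ + _).
rewrite muniZ muni_X -!mul_polyC !poly_to_mpolyM !poly_to_mpolyC poly_to_mpolyXn.
rewrite mwidenC mwidenX mul_mpolyC; congr (_ *: _).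
rewrite [in RHS]mpolyXE_id big_ord_recr /= mpolyXE_id big_ord_recr /=.
rewrite mnmwiden_ordmax expr0 mulr1; congr (_ * _).
by apply: eq_bigr => l _; rewrite mnmwiden_widen mnmE.
Qed.

Lemma mpoly_factorial n : factorial_ring {mpoly F[n]}.
Proof.
elim: n => [|n IHn].
  move=> p p0; apply: factors_unit.
  apply/andP; split; first by apply/eqP; rewrite mpolyKC.
  by rewrite unitfE; apply: contraNneq p0 => p00; rewrite -[p]mpolyKC p00.
apply: (can_factorial (@muniK n) (@poly_to_mpolyK n)) (poly_factorial IHn).
- exact: muniM.
- exact: muni1.
- exact: poly_to_mpolyM.
- exact: poly_to_mpoly1.
- exact: poly_to_mpoly0.
Qed.

End MPolyFactorial.

(** * Zeros and factors of polynomials in several variables *)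

Section HomogeneousFactors.
Variables (F : fieldType) (n : nat).
Implicit Types p q : {mpoly F[n]}.

(* p(tX), as a polynomial in t. *)
Definition dilation p : {poly {mpoly F[n]}} :=
  mmap (polyC \o @mpolyC n F) (fun i => ('X_i)%:P * 'X) p.

Lemma dilationM p q : dilation (p * q) = dilation p * dilation q.
Proof. exact: rmorphM. Qed.

Lemma coef_dilation p e : (dilation p)`_e = pihomog mdeg e p.
Proof.
elim/mpolyind: p => [|c m p _ _ IHp]; first by rewrite [dilation 0]mmap0 coef0 pihomog0.
rewrite [dilation _]mmapD coefD [X in _ + X]IHp pihomogD; congr (_ + _).
rewrite /dilation mmapZ mmapX linearZ /= pihomogX /mmap1.
under eq_bigr do rewrite exprMn -rmorphXn.
rewrite big_split /= -rmorph_prod /= -mpolyXE_id prodrXr -mdegE.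
rewrite coefCM coefCM coefXn eq_sym mul_mpolyC.
by case: eqP; rewrite ?mulr1 ?mulr0.
Qed.

Lemma dilation_homog p d : p \is d.-homog -> dilation p = p *: 'X^d.
Proof.
move=> hp; apply/polyP => e; rewrite coef_dilation coefZ coefXn.
have [->|ed] := eqVneq e d; first by rewrite mulr1 pihomog_dE.
by rewrite mulr0 (pihomog_ne0 (d := d)) // eq_sym.
Qed.

(** The dilation of [p * q] is [p * q] times t^d. Its divisor [dilation p] is therefore a power of t
    up to constants, which leaves [p] a single homogeneous component. *)
Lemma dhomog_factor p q d : p != 0 -> q != 0 -> p * q \is d.-homog ->
  exists d1, p \is d1.-homog.
Proof.
move=> p0 q0 hpq.
have e : (p * q) *: 'X^d = dilation q * dilation p.
  by rewrite -(dilation_homog hpq) dilationM; apply: mulrC.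
(* Written with the root 0, so that the classification of divisors of a power of a monic linear
   polynomial applies. *)
have : dilation p %| ('X - 0%:P) ^+ d.
  rewrite subr0; apply/Pdiv.WeakIdomain.dvdpP.
  exists (p * q, dilation q); first exact: mulf_neq0.
  exact: e.
case/dvdp_exp_XsubCP => a _; rewrite subr0.
case/eqpP=> -[c1 c2] /= /andP[c10 c20] {}e; exists a.
rewrite [p](@pihomog_partitionE _ _ mdeg (msize p)) //.
apply: rpred_sum => b _; have [<-|ba] := eqVneq (b : nat) a; first exact: pihomogP.
have := congr1 (fun r : {poly _} => r`_b) e.
rewrite !coefZ coef_dilation coefXn (negbTE ba) mulr0 => /eqP.
by rewrite mulf_eq0 (negbTE c10) => /eqP->; apply: rpred0.
Qed.

Lemma dhomog_factors p q d : p != 0 -> q != 0 -> p * q \is d.-homog ->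
  exists d1 d2, [/\ p \is d1.-homog, q \is d2.-homog & (d1 + d2)%N = d].
Proof.
move=> p0 q0 hpq; have [a hp] := dhomog_factor p0 q0 hpq.
have [b hq] : exists b, q \is b.-homog.
  by apply: (dhomog_factor (q := p) q0 p0 (d := d)); rewrite mulrC.
exists a, b; split=> //; apply: dhomog_uniq (dhomogM hp hq) hpq.
exact: mulf_neq0.
Qed.

End HomogeneousFactors.

(** * Polynomials without zeros off the origin, over an algebraically closed field *)

Section Zeros.
Variable k : closedFieldType.

Lemma horner_neq0_size1 (P : {poly k}) : (forall s, P.[s] != 0) -> size P = 1%N.
Proof.
move=> P0; apply/eqP/negPn/negP => /closed_rootP[s /eqP Ps].
by have := P0 s; rewrite Ps eqxx.
Qed.

(** [P + 1] takes only the value 1, so it has no root and is constant. *)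
Lemma horner_eq0 (P : {poly k}) : (forall s, P.[s] = 0) -> P = 0.
Proof.
move=> P0; have /size_poly1P[c c0 Pc] : size (P + 1) == 1%N.
  by apply/eqP/horner_neq0_size1 => s; rewrite hornerD P0 hornerC add0r oner_neq0.
have := congr1 (fun q => q.[0]) Pc; rewrite hornerD P0 !hornerC add0r => c1.
by rewrite -[P](addrK 1) Pc -c1 subrr.
Qed.

Lemma meval_mwiden n (p : {mpoly k[n]}) (x : 'I_n.+1 -> k) :
  (mwiden p).@[x] = p.@[fun i => x (widen_ord (leqnSn n) i)].
Proof.
elim/mpolyind: p => [|c m p _ _ IHp]; first by rewrite mwiden0 !meval0.
rewrite mwidenD !mevalD IHp mwidenZ !mevalZ mwidenX !mevalX; congr (_ * _ + _).
rewrite big_ord_recr /= mnmwiden_ordmax expr0 mulr1.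
by apply: eq_bigr => i _; rewrite mnmwiden_widen.
Qed.

Lemma meval_poly_to_mpoly n (p : {poly {mpoly k[n]}}) (x : 'I_n.+1 -> k) :
  (poly_to_mpoly p).@[x] =
    (map_poly (meval (fun i => x (widen_ord (leqnSn n) i))) p).[x ord_max].
Proof.
elim/poly_ind: p => [|p c IHp]; first by rewrite poly_to_mpoly0 meval0 rmorph0 horner0.
rewrite poly_to_mpolyD poly_to_mpolyM mevalD mevalM IHp.
rewrite -['X]expr1 poly_to_mpolyXn poly_to_mpolyC !expr1 mevalXU meval_mwiden.
by rewrite rmorphD rmorphM /= map_polyC map_polyX hornerD hornerM hornerX hornerC.
Qed.

Lemma meval_eq0 n (p : {mpoly k[n]}) : (forall x, p.@[x] = 0) -> p = 0.
Proof.
elim: n p => [|n IHn] p p0.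
  rewrite -[p]mpolyKC; have := p0 (fun=> 0).
  by rewrite -[in p.@[_]](mpolyKC p) mevalC => ->.
rewrite -[p]muniK; suff -> : muni p = 0 by rewrite poly_to_mpoly0.
apply/polyP => e; rewrite coef0; apply: IHn => x.
rewrite -(coef_map (meval x)) /=.
suff -> : map_poly (meval x) (muni p) = 0 by rewrite coef0.
apply: horner_eq0 => t.
(* The point [x] extended by [t] in the last coordinate. *)
pose y (i : 'I_n.+1) := if unlift ord_max i is Some l then x l else t.
rewrite -[RHS](p0 y) -[in RHS](muniK p) meval_poly_to_mpoly {2}/y unlift_none.
congr (_.[t]); apply/polyP => l; rewrite !coef_map /=.
apply: meval_eq => i; rewrite /y.
have -> : widen_ord (leqnSn n) i = lift ord_max i by apply: val_inj; apply/esym/lift_max.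
by rewrite liftK.
Qed.

(** The product [p * 'X_l] vanishes everywhere. This allows identities to be tested at nonzero
    points only. *)
Lemma meval_eq0_off_hyperplane n (p : {mpoly k[n]}) (l : 'I_n) :
  (forall x, x l != 0 -> p.@[x] = 0) -> p = 0.
Proof.
move=> p0; apply/eqP; have : p * 'X_l = 0.
  apply: meval_eq0 => x; rewrite mevalM mevalXU.
  by have [->|/p0->] := eqVneq (x l) 0; rewrite ?mulr0 ?mul0r.
move/eqP; rewrite mulf_eq0 => /orP[//|/eqP/(congr1 (mcoeff U_(l)))].
by rewrite mcoeffXU eqxx mcoeff0 => /eqP; rewrite oner_eq0.
Qed.

Definition pencil n (p : {mpoly k[n]}) (x y : 'I_n -> k) : {poly k} :=
  mmap polyC (fun i => (x i)%:P + (y i)%:P * 'X) p.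

Lemma horner_pencil n (p : {mpoly k[n]}) (x y : 'I_n -> k) s :
  (pencil p x y).[s] = p.@[fun i => x i + y i * s].
Proof.
rewrite /pencil; elim/mpolyind: p => [|c m p _ _ IHp].
  by rewrite mmap0 meval0 horner0.
rewrite mmapD mevalD hornerD IHp mmapZ mevalZ hornerM hornerC mmapX mevalX.
congr (_ * _ + _); rewrite horner_prod; apply: eq_bigr => i _.
by rewrite horner_exp hornerD hornerM !hornerC hornerX.
Qed.

(* On the affine hyperplane through [x] where coordinate [l] is constant,
   the line from [x] to [y] avoids the origin. *)
Lemma nonvanishing_constant n (p : {mpoly k[n]}) (l : 'I_n) (x y : 'I_n -> k) :
    (forall z, (exists i, z i != 0) -> p.@[z] != 0) ->
  x l != 0 -> x l = y l -> p.@[x] = p.@[y].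
Proof.
move=> p0 xl xyl; pose P := pencil p x (fun i => y i - x i).
have /eqP/size_poly1P[c _ PE] : size P = 1%N.
  apply: horner_neq0_size1 => s; rewrite horner_pencil; apply: p0.
  by exists l; rewrite xyl subrr mul0r addr0 -xyl.
transitivity P.[0].
  by rewrite horner_pencil; apply: meval_eq => i; rewrite mulr0 addr0.
transitivity P.[1]; first by rewrite PE !hornerC.
by rewrite horner_pencil; apply: meval_eq => i; rewrite mulr1 addrCA subrr addr0.
Qed.

(** Any point with a nonzero coordinate [l0] is joined to the point with all coordinates 1 by two
    lines that avoid the origin, so [p] is constant. The second line fixes another coordinate [l1],
    whence two variables. *)
Lemma nonvanishing_unit n (p : {mpoly k[n]}) : (2 <= n)%N ->
  (forall z, (exists i, z i != 0) -> p.@[z] != 0) -> p \is a GRing.unit.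
Proof.
move=> n2 p0; pose l0 : 'I_n := Ordinal (ltnW n2); pose l1 : 'I_n := Ordinal n2.
pose c := p.@[fun=> 1].
have pc : p = c%:MP.
  apply/eqP; rewrite -subr_eq0; apply/eqP/(meval_eq0_off_hyperplane (l := l0)) => x xl.
  rewrite mevalB mevalC; apply/eqP; rewrite subr_eq0; apply/eqP.
  (* The corner of the path: it shares coordinate [l0] with [x] and coordinate [l1] with the
     all-ones point. *)
  pose y i := if i == l0 then x l0 else 1.
  rewrite (nonvanishing_constant (l := l0) (y := y)) ?/y ?eqxx //.
  by apply: (nonvanishing_constant (l := l1)) => //; rewrite /= oner_neq0.
have c0 : c != 0 by apply: p0; exists l0; apply: oner_neq0.
by rewrite pc; apply/(rmorph_unit (@mpolyC n k)); rewrite unitfE.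
Qed.

Definition nonvanishing n (I : Type) (f : I -> {mpoly k[n]}) :=
  forall x, (exists i, x i != 0) -> exists i, (f i).@[x] != 0.

(** A common prime divisor would have no zero off the origin, hence would be a unit. *)
Lemma nonvanishing_coprime n (I : Type) (f : I -> {mpoly k[n]}) : (2 <= n)%N ->
  nonvanishing f -> coprime_family f.
Proof.
move=> n2 f0; have [|i fi0] := f0 (fun=> 1).
  by exists (Ordinal n2); apply: oner_neq0.
have /mpoly_factorial[u [s [uu ps fi]]] : f i != 0.
  by apply: contraNneq fi0 => ->; rewrite meval0.
exists i, u, s; split=> // x /ps[_ xu _]; apply/existsNP => xf.
case/negP: xu; apply: nonvanishing_unit => // z /f0[l].
by have [g ->] := xf l; rewrite mevalM mulf_eq0 negb_or => /andP[].
Qed.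

(** Coprimality of [f] turns pointwise proportionality into [f' = c * f] for one polynomial [c]. As
    [f'] vanishes nowhere off the origin, neither does [c], so [c] is a constant. *)
Lemma nonvanishing_degree n (I : Type) (f f' : I -> {mpoly k[n]}) d d' :
    (2 <= n)%N -> nonvanishing f -> nonvanishing f' ->
    (forall i, f i \is d.-homog) -> (forall i, f' i \is d'.-homog) ->
    (forall x, (exists i, x i != 0) ->
      forall i l, (f i).@[x] * (f' l).@[x] = (f l).@[x] * (f' i).@[x]) ->
  d = d'.
Proof.
move=> n2 f0 f'0 hf hf' ff'; pose l0 : 'I_n := Ordinal n2.
have [i l|c cE] := coprime_family_proportional (nonvanishing_coprime n2 f0) (r := f').
  apply/eqP; rewrite -subr_eq0; apply/eqP/(meval_eq0_off_hyperplane (l := l0)) => x xl.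
  by rewrite mevalB !mevalM ff' ?subrr //; exists l0.
have /andP[/eqP cC _] : c \is a GRing.unit.
  apply: nonvanishing_unit => // z /f'0[i].
  by rewrite cE mevalM mulf_eq0 negb_or => /andP[].
have [|i f'i0] := f'0 (fun=> 1); first by exists l0; apply: oner_neq0.
apply: (dhomog_uniq (mf := mdeg) (p := f' i)) => //.
  by apply: contraNneq f'i0 => ->; rewrite meval0.
by rewrite cE cC mul_mpolyC; apply: dhomogZ.
Qed.

End Zeros.
(** * Plücker coordinates of families of subspaces *)

Section PolynomialFunctions.
Variables (k : closedFieldType) (A : vectType k).
Local Notation n := (\dim {:A}).
Implicit Types (phi psi : A -> k) (x : A).

Definition pt x : 'I_n -> k := fun a => coord (vbasis {:A}) a x.

Lemma pt_neq0 x : (exists a, pt x a != 0) <-> x != 0.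
Proof.
split=> [[a]|]; first by apply: contraNneq => ->; rewrite /pt linear0.
apply: contra_neqP => /forallNP x0.
rewrite (coord_vbasis (memvf x)) big1 // => a _.
by have /negP/negPn/eqP := x0 a; rewrite /pt => ->; rewrite scale0r.
Qed.

Lemma pt_surj (z : 'I_n -> k) : exists x, pt x =1 z.
Proof.
exists (\sum_a z a *: (vbasis {:A})`_a) => a.
by rewrite /pt coord_sum_free // (basis_free (vbasisP _)).
Qed.

Lemma nonvanishingP (I : Type) (f : I -> {mpoly k[n]}) :
  nonvanishing f <-> forall x, x != 0 -> exists i, (f i).@[pt x] != 0.
Proof.
split=> f0 x; first by move/pt_neq0/f0.
have [y yx] := pt_surj x; move=> [a xa].
have [|i fi] := f0 y; first by apply/pt_neq0; exists a; rewrite yx.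
by exists i; rewrite -(meval_eq _ yx).
Qed.

Lemma mpoly_eq_pt (f g : {mpoly k[n]}) : (0 < n)%N ->
  (forall x, x != 0 -> f.@[pt x] = g.@[pt x]) -> f = g.
Proof.
move=> n0 fg; apply/eqP; rewrite -subr_eq0; apply/eqP.
apply: (meval_eq0_off_hyperplane (l := Ordinal n0)) => z z0.
have [x xz] := pt_surj z; rewrite -(meval_eq _ xz) mevalB fg ?subrr //.
by apply/pt_neq0; exists (Ordinal n0); rewrite xz.
Qed.

(** Homogeneity is attached to functions on [A], so that products, determinants and iterated
    operators are formed pointwise before a polynomial is chosen. *)
Definition hpolyfun d phi :=
  exists2 P : {mpoly k[n]}, P \is d.-homog & forall x, phi x = P.@[pt x].

Lemma eq_hpolyfun d phi psi : phi =1 psi -> hpolyfun d phi -> hpolyfun d psi.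
Proof. by move=> e [P hP PE]; exists P => // x; rewrite -e. Qed.

Lemma hpolyfun_sum d (J : finType) (F : J -> A -> k) :
  (forall l, hpolyfun d (F l)) -> hpolyfun d (fun x => \sum_l F l x).
Proof.
move=> hF.
have /choice[P PE] : forall l, exists P : {mpoly k[n]},
    P \is d.-homog /\ forall x, F l x = P.@[pt x].
  by move=> l; have [P ? ?] := hF l; exists P.
exists (\sum_l P l); first by apply: rpred_sum => l _; have [] := PE l.
by move=> x; rewrite raddf_sum; apply: eq_bigr => l _; have [_] := PE l.
Qed.

Lemma hpolyfunM d e phi psi : hpolyfun d phi -> hpolyfun e psi ->
  hpolyfun (d + e) (fun x => phi x * psi x).
Proof.
move=> [P hP PE] [Q hQ QE]; exists (P * Q); first exact: dhomogM.
by move=> x; rewrite mevalM PE QE.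
Qed.

Lemma hpolyfun_cst c : hpolyfun 0 (fun=> c).
Proof.
exists c%:MP; last by move=> x; rewrite mevalC.
by rewrite -[c]mulr1 mpolyCM mul_mpolyC; apply: dhomogZ; apply: dhomog1.
Qed.

Lemma hpolyfun_prod d e (F : 'I_e -> A -> k) :
  (forall l, hpolyfun d (F l)) -> hpolyfun (d * e) (fun x => \prod_l F l x).
Proof.
elim: e F => [|e IHe] F hF.
  rewrite muln0; apply: eq_hpolyfun (hpolyfun_cst 1) => x.
  by rewrite big_ord0.
rewrite mulnS; apply: (@eq_hpolyfun _ (fun x => F ord0 x * \prod_l F (lift ord0 l) x)).
  by move=> x; rewrite big_ord_recl.
by apply: hpolyfunM => //; apply: IHe.
Qed.

Lemma hpolyfun_det d e (F : 'I_e -> 'I_e -> A -> k) :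
    (forall a b, hpolyfun d (F a b)) ->
  hpolyfun (d * e) (fun x => \det (\matrix_(a, b) F a b x)).
Proof.
(* In the Leibniz expansion the sign is a constant of degree 0, whence the summand [0]. *)
move=> hF; apply: hpolyfun_sum => s; rewrite -[(d * e)%N]add0n.
apply: hpolyfunM; first exact: hpolyfun_cst.
have [P hP PE] := hpolyfun_prod (fun a => hF a (s a)).
by exists P => // x; rewrite -PE; apply: eq_bigr => a _; rewrite mxE.
Qed.

Lemma hpolyfun_linear phi : linear_for *%R phi -> hpolyfun 1 phi.
Proof.
move=> lphi; pose e := vbasis {:A}.
pose ph : {linear A -> k^o} := HB.pack phi (GRing.isLinear.Build _ _ _ _ phi lphi).
exists (\sum_(a < n) phi e`_a *: 'X_a).
  by apply: rpred_sum => a _; apply: dhomogZ; rewrite dhomogX /= mdeg1.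
move=> x; transitivity (ph (\sum_a coord e a x *: e`_a)).
  by rewrite -coord_vbasis ?memvf.
rewrite linear_sum raddf_sum; apply: eq_bigr => a _.
by rewrite linearZ /= mevalZ mevalXU [RHS]mulrC.
Qed.

End PolynomialFunctions.

(** * Wedge products and bases of subspaces *)

Section Wedge.
Variables (k : fieldType) (W : vectType k) (d : nat).
Implicit Types (w b : 'I_d -> W) (L : {vspace W}).

Lemma wedge_mul (C : 'M[k]_d) w b :
  (forall a, w a = \sum_c C a c *: b c) -> wedge w = \det C *: wedge b.
Proof.
move=> wE; apply/ffunP => I; rewrite !ffunE.
apply: etrans (det_mulmx C _); congr (\det _).
apply/matrixP => a c; rewrite !mxE wE linear_sum; apply: eq_bigr => l _.
by rewrite mxE linearZ.
Qed.

(** The family behind [pl_vect], for a subspace that carries no proof of its dimension; positions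
    beyond the dimension hold the default 0. *)
Definition pl_basis L : 'I_d -> W := fun a => (vbasis L)`_a.

Lemma pl_basis_mem L a : pl_basis L a \in L.
Proof.
rewrite /pl_basis; have [h|h] := ltnP a (size (vbasis L)).
  by apply: vbasis_mem; apply: mem_nth.
by rewrite nth_default // mem0v.
Qed.

Lemma pl_basis_span L v : \dim L = d -> v \in L ->
  exists c : 'I_d -> k, v = \sum_a c a *: pl_basis L a.
Proof.
move=> dL /coord_vbasis->; exists (fun a => coord (vbasis L) (cast_ord (esym dL) a) v).
rewrite [RHS](reindex (cast_ord dL)) /=; last first.
  by exists (cast_ord (esym dL)) => ? _; rewrite ?cast_ordK ?cast_ordKV.
by apply: eq_bigr => a _; rewrite cast_ordK.
Qed.

Lemma pl_basis_wedge_neq0 L : \dim L = d -> wedge (pl_basis L) != 0.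
Proof.
move=> /eqP dL; have := pl_subproof (Sub L dL : Gr d W).
by rewrite dim_vline eqb1.
Qed.

Lemma pl_basis_free L (c : 'I_d -> k) : \dim L = d ->
  \sum_a c a *: pl_basis L a = 0 -> forall a, c a = 0.
Proof.
move=> dL c0 a; have /freeP fr := basis_free (vbasisP L).
rewrite -[a](cast_ordKV dL).
apply: (fr (fun a => c (cast_ord dL a))); rewrite -[RHS]c0.
rewrite [RHS](reindex (cast_ord dL)) //=.
by exists (cast_ord (esym dL)) => ? _; rewrite ?cast_ordK ?cast_ordKV.
Qed.

Lemma wedge_in_line L w : \dim L = d -> (forall a, w a \in L) ->
  exists lam, wedge w = lam *: wedge (pl_basis L).
Proof.
move=> dL wL; have /choice[C CE] := fun a => pl_basis_span dL (wL a).
exists (\det (\matrix_(a, c) C a c)); apply: wedge_mul => a.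
by rewrite CE; apply: eq_bigr => c _; rewrite mxE.
Qed.

(** A spanning family contains a basis. The matrix [Tm] of [w] in [pl_basis L] has a left inverse
    [Um], so [d] of its rows form an invertible matrix. *)
Lemma wedge_span_neq0 m L (w : 'I_m -> W) : \dim L = d ->
    (forall a, w a \in L) ->
    (forall v, v \in L -> exists u : 'I_m -> k, v = \sum_a u a *: w a) ->
  exists c : {ffun 'I_d -> 'I_m}, wedge (fun a => w (c a)) != 0.
Proof.
move=> dL wL spL; have /choice[T TE] := fun a => pl_basis_span dL (wL a).
have /choice[U UE] := fun a : 'I_d => spL _ (pl_basis_mem L a).
pose Tm := \matrix_(a < m, c < d) T a c; pose Um := \matrix_(a < d, c < m) U a c.
have UT1 : Um *m Tm = 1%:M.
  apply/matrixP => a c; apply/eqP; rewrite -subr_eq0; apply/eqP.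
  apply: (pl_basis_free (c := fun c => (Um *m Tm) a c - 1%:M a c) dL).
  under eq_bigr do rewrite scalerBl; rewrite sumrB.
  rewrite [X in _ - X](bigD1 a) //= !mxE eqxx scale1r [X in _ - (_ + X)]big1 ?addr0.
    apply/eqP; rewrite subr_eq0 [X in _ == X]UE; apply/eqP.
    under eq_bigr do rewrite !mxE scaler_suml.
    rewrite exchange_big /=; apply: eq_bigr => l _; rewrite TE scaler_sumr.
    by apply: eq_bigr => e _; rewrite !mxE scalerA.
  by move=> l la; rewrite !mxE eq_sym (negbTE la) scale0r.
have fullT : row_full Tm by rewrite -sub1mx -UT1 submxMl.
exists (fullrankfun fullT); set c := fullrankfun fullT.
rewrite (@wedge_mul (rowsub c Tm) _ (pl_basis L)); last first.
  by move=> a; rewrite TE; apply: eq_bigr => e _; rewrite !mxE.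
rewrite scaler_eq0 negb_or pl_basis_wedge_neq0 // andbT.
by rewrite -unitfE -unitmxE -row_full_unit; apply: fullrowsub_full.
Qed.

End Wedge.

(** * Factorization of the minors of a polynomial spanning family *)

Section PluckerFactorization.
Variables (k : closedFieldType) (A W : vectType k) (d D m : nat).
Hypothesis dimA : (2 <= \dim {:A})%N.
Variables (L : A -> {vspace W}) (w : 'I_m -> A -> W).
Hypothesis dimL : forall x : A, x != 0 -> \dim (L x) = d.
Hypothesis wL : forall x a, w a x \in L x.
Hypothesis spanL : forall x v, v \in L x ->
  exists u : 'I_m -> k, v = \sum_a u a *: w a x.
Hypothesis polyw : forall a i, hpolyfun D (fun x => coord (vbasis {:W}) i (w a x)).

Local Notation S := {mpoly k[\dim {:A}]}.
Local Notation idx := {I : {set 'I_(\dim {:W})} | #|I| == d}.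

Definition ext_eval (F : idx -> S) (x : A) : Ext d W :=
  [ffun I => (F I).@[pt x]].

(** All vectors [G c] at [x] lie on the Plücker line of [L x], so the polynomial matrix [G c I] has
    rank at most one. One nonzero row divided by its gcd is [F], and every row is then a polynomial
    multiple [v c] of [F]. *)
Lemma plucker_factorization :
  exists e D' (F : idx -> S) (v : {ffun 'I_d -> 'I_m} -> S),
  [/\ forall I, F I \is e.-homog, forall c, v c \is D'.-homog, (D' + e = D * d)%N,
      nonvanishing v &
      forall x : A, x != 0 ->
        [/\ exists2 kap : k, kap != 0 &
              ext_eval F x = kap *: wedge (pl_basis (d := d) (L x))
         & forall c : {ffun 'I_d -> 'I_m},
             wedge (fun a => w (c a) x) = (v c).@[pt x] *: ext_eval F x]].
Proof.
have n0 : (0 < \dim {:A})%N := ltnW dimA.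
have [G hG GE] : exists2 G : {ffun 'I_d -> 'I_m} -> idx -> S,
    forall c I, G c I \is (D * d).-homog &
    forall (c : {ffun 'I_d -> 'I_m}) x, wedge (fun a => w (c a) x) = ext_eval (G c) x.
  have /choice[G GE] : forall cI : {ffun 'I_d -> 'I_m} * idx, exists P : S,
      P \is (D * d).-homog /\
      forall x, wedge (fun a => w (cI.1 a) x) cI.2 = P.@[pt x].
    case=> c I; have [] := @hpolyfun_det k A D d
      (fun a b x => coord (vbasis {:W}) (subset_nth I b) (w (c a) x)).
      by move=> a b; apply: polyw.
    by move=> P hP PE; exists P; split=> // x; rewrite ffunE PE.
  exists (fun c I => G (c, I)) => [c I|c x]; first by have [] := GE (c, I).
  by apply/ffunP => I; have [_ e] := GE (c, I); rewrite [RHS]ffunE; apply: e.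
have Gline c x : x != 0 ->
    exists lam, ext_eval (G c) x = lam *: wedge (pl_basis (d := d) (L x)).
  by move=> x0; rewrite -GE; apply: wedge_in_line => //; apply: dimL.
have Gneq0 x : x != 0 -> exists c, ext_eval (G c) x != 0.
  move=> x0; have [c wc] := wedge_span_neq0 (dimL x0) (wL x) (@spanL x).
  by exists c; rewrite -GE.
have evE (F : idx -> S) x I : (F I).@[pt x] = ext_eval F x I by rewrite ffunE.
have Gprop c c' I J : G c I * G c' J = G c J * G c' I.
  apply: mpoly_eq_pt => // x x0; rewrite !mevalM !evE.
  have [lam ->] := Gline c x x0; have [lam' ->] := Gline c' x x0.
  by rewrite !ffunE /= /GRing.scale /= mulrACA [X in _ * X]mulrC mulrACA.
have [x1 x10] : exists x : A, x != 0.
  have [x x1] := @pt_surj k A (fun=> 1); exists x; apply/pt_neq0.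
  by exists (Ordinal n0); rewrite x1 oner_neq0.
have [c0 Gc0] := Gneq0 _ x10.
have [I0 GI0] : exists I, G c0 I != 0.
  apply: contra_neqP Gc0 => /forallNP z; apply/ffunP => I; rewrite !ffunE.
  by have /negP/negPn/eqP -> := z I; rewrite meval0.
have [h [F [h0 cF GF]]] := factors_coprime_family (mpoly_factorial GI0).
have FI0 : F I0 != 0 by apply: contraNneq GI0; rewrite GF => ->; rewrite mulr0.
have /choice[v vE] : forall c, exists v, forall I, G c I = v * F I.
  move=> c; apply: coprime_family_proportional => // I J.
  by apply: (mulfI h0); rewrite !mulrA -!GF Gprop.
have [|eh [e [hh hF ehe]]] := dhomog_factors h0 FI0 (d := (D * d)%N); first by rewrite -GF.
(* A zero [F I] is homogeneous of any degree. For the others, the factor [h] has the fixed degree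
   [eh] in every product [h * F I], so all degrees agree. *)
have hFI I : F I \is e.-homog.
  have [->|FI] := eqVneq (F I) 0; first exact: rpred0.
  have [|a [b [ha hb ab]]] := dhomog_factors h0 FI (d := (D * d)%N); first by rewrite -GF.
  by rewrite -(addnI (_ : eh + b = eh + e)%N) // ehe -ab (dhomog_uniq h0 hh ha).
have evG c x : ext_eval (G c) x = (v c).@[pt x] *: ext_eval F x.
  by apply/ffunP => I; rewrite !ffunE vE mevalM.
(* The multipliers [v c] have the degree [eh] of [h], since both complete [F] to minors of degree
   [D * d]. *)
exists e, eh, F, v; split=> //.
- move=> c; have [->|vc] := eqVneq (v c) 0; first exact: rpred0.
  have [|a [b [ha hb ab]]] := dhomog_factors vc FI0 (d := (D * d)%N); first by rewrite -vE.
  suff -> : eh = a by [].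
  by apply/eqP; rewrite -(eqn_add2r e) ehe -ab (dhomog_uniq FI0 hF hb).
- apply/nonvanishingP => x /Gneq0[c]; rewrite evG => Gc; exists c.
  by apply: contraNneq Gc => ->; rewrite scale0r.
- move=> x x0; split; last by move=> c; rewrite GE.
  have [c] := Gneq0 _ x0; have [lam] := Gline c x x0; rewrite evG => lE.
  rewrite scaler_eq0 negb_or => /andP[vc Fx].
  exists ((v c).@[pt x]^-1 * lam); last by rewrite -scalerA -lE scalerA mulVf ?scale1r.
  rewrite mulf_neq0 ?invr_eq0 //; apply: contraNneq Fx => l0.
  move: lE => /(congr1 ( *:%R ((v c).@[pt x]^-1))).
  by rewrite scalerA mulVf // scale1r l0 scale0r scaler0 => ->.
Qed.

(** Both [F] at [x] and the wedge of [b] are multiples of the same Plücker vector. The ratio [mu] of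
    the two scalars does not depend on [c], and it is nonzero because some [v c] is nonzero at
    [x]. *)
Lemma minors_of_basis (F : idx -> S) (v : {ffun 'I_d -> 'I_m} -> S) x (b : 'I_d -> W) :
    x != 0 -> nonvanishing v ->
    (exists2 kap : k, kap != 0 &
      ext_eval F x = kap *: wedge (pl_basis (d := d) (L x))) ->
    (forall c : {ffun 'I_d -> 'I_m},
      wedge (fun a => w (c a) x) = (v c).@[pt x] *: ext_eval F x) ->
    (forall a, b a \in L x) ->
    (forall y, y \in L x -> exists u : 'I_d -> k, y = \sum_a u a *: b a) ->
  exists2 mu : k, mu != 0 & forall (c : {ffun 'I_d -> 'I_m}) (C : 'M_d),
    (forall a, w (c a) x = \sum_l C a l *: b l) -> (v c).@[pt x] = mu * \det C.
Proof.
move=> x0 v0 [kap kap0 FE] wE bL spb.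
have [lam lE] := wedge_in_line (dimL x0) bL.
have P0 := pl_basis_wedge_neq0 (dimL x0).
have vE (c : {ffun 'I_d -> 'I_m}) (C : 'M_d) :
    (forall a, w (c a) x = \sum_l C a l *: b l) ->
    (v c).@[pt x] = lam / kap * \det C.
  move=> /wedge_mul; rewrite wE lE FE !scalerA => /eqP.
  rewrite -subr_eq0 -scalerBl scaler_eq0 (negbTE P0) orbF subr_eq0 => /eqP e.
  by apply: (mulIf kap0); rewrite e mulrAC divfK // mulrC.
exists (lam / kap) => //.
have [c vc] := (nonvanishingP _).1 v0 x x0.
have /choice[C CE] := fun a => spb _ (wL x (c a)).
have := vE c (\matrix_(a, l) C a l); rewrite /= => vcE.
apply: contraNneq vc => mu0; rewrite vcE ?mu0 ?mul0r // => a.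
by rewrite CE; apply: eq_bigr => l _; rewrite mxE.
Qed.

End PluckerFactorization.
(** * Degrees of modules of constant rank *)

Lemma vlineZ (k : fieldType) (W : vectType k) (c : k) (v : W) :
  c != 0 -> <[c *: v]>%VS = <[v]>%VS.
Proof.
move=> c0; apply/eqP; rewrite eqEsubv -!memvE memvZ ?memv_line //=.
by rewrite -{1}[v](scalerK c0) memvZ ?memv_line.
Qed.

Section DegreeUniqueness.
Variables (k : closedFieldType) (A B : vectType k).
Hypothesis dimA : (2 <= \dim {:A})%N.

(** Since [U] is everything, each coordinate family spans the line [phi L] at every nonzero point.
    The two families thus vanish nowhere off the origin and are proportional, and
    [nonvanishing_degree] applies. *)
Lemma has_degree_unique (U : pred (Proj A)) (phi : {L : Proj A | U L} -> Proj B) d d' :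
  (forall L, U L) -> has_degree phi d -> has_degree phi d' -> d = d'.
Proof.
move=> UT [f [hf _ fE]] [f' [hf' _ f'E]].
pose ev (g : 'I_(\dim {:B}) -> {mpoly k[\dim {:A}]}) (x : A) :=
  \sum_i (g i).@[pt x] *: (vbasis {:B})`_i.
have evi g x i : coord (vbasis {:B}) i (ev g x) = (g i).@[pt x].
  by rewrite coord_sum_free // (basis_free (vbasisP _)).
have line (x : A) : x != 0 -> exists2 P : {vspace B}, \dim P = 1%N &
    P = <[ev f x]>%VS /\ P = <[ev f' x]>%VS.
  move=> x0; have dx : \dim <[x]>%VS == 1%N by rewrite dim_vline x0.
  pose L0 : Proj A := Sub <[x]>%VS dx.
  pose L : {L : Proj A | U L} := Sub L0 (UT L0).
  exists (val (phi L)); first by apply/eqP/(valP (phi L)).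
  by split; [apply: fE | apply: f'E]; rewrite ?memv_line.
have nv g : (forall x : A, x != 0 -> ev g x != 0) -> nonvanishing g.
  move=> g0; apply/nonvanishingP => x /g0; apply: contra_neqP => /forallNP z.
  apply: big1 => i _; have /negP/negPn/eqP -> := z i; exact: scale0r.
have ev0 (x : A) : x != 0 -> ev f x != 0 /\ ev f' x != 0.
  move=> /line[P P1 [PE PE']].
  have := P1; rewrite PE dim_vline; case: eqP => // _ _.
  by have := P1; rewrite PE' dim_vline; case: eqP.
apply: (nonvanishing_degree dimA (nv f _) (nv f' _) hf hf').
- by move=> x /ev0[].
- by move=> x /ev0[].
move=> z [a za] i l; have [x xz] := pt_surj z.
rewrite -!(meval_eq _ xz) -!evi.
have x0 : x != 0 by apply/pt_neq0; exists a; rewrite xz.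
have [P _ [PE PE']] := line x x0.
have /vlineP[c ->] : ev f' x \in <[ev f x]>%VS by rewrite -PE PE' memv_line.
by rewrite !linearZ /= mulrCA [RHS]mulrCA; congr (_ * _); apply: mulrC.
Qed.

End DegreeUniqueness.

Section ExtDegree.
Variables (k : closedFieldType) (A W : vectType k) (d : nat).
Hypothesis dimA : (2 <= \dim {:A})%N.
Local Notation S := {mpoly k[\dim {:A}]}.
Local Notation idx := {I : {set 'I_(\dim {:W})} | #|I| == d}.
Variables (F : idx -> S) (e : nat).
Hypothesis hF : forall I, F I \is e.-homog.
Hypothesis F0 : forall x : A, x != 0 -> ext_eval F x != 0.

Lemma ext_eval_has_degree (U : pred (Proj A))
    (phi : {L : Proj A | U L} -> Proj (Ext d W)) :
    (forall (L : {L : Proj A | U L}) (x : A), x \in val (val L) -> x != 0 ->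
      val (phi L) = <[ext_eval F x]>%VS) ->
  has_degree phi e.
Proof.
move=> phiE; pose b := vbasis {:Ext d W}.
pose delta (I : idx) : Ext d W := [ffun J => (J == I)%:R].
(* [has_degree] asks for coordinates in [vbasis {:Ext d W}], while [F] is indexed by the basis
   [delta]. The change of basis is constant and keeps the degree. *)
pose f i := \sum_I coord b i (delta I) *: F I.
have fE i x : (f i).@[pt x] = coord b i (ext_eval F x).
  have -> : ext_eval F x = \sum_I (F I).@[pt x] *: delta I.
    apply/ffunP => J; rewrite ffunE sum_ffunE (bigD1 J) //= big1 ?addr0.
      by rewrite !ffunE eqxx; apply/esym/mulr1.
    by move=> I IJ; rewrite !ffunE eq_sym (negbTE IJ); apply: mulr0.
  rewrite raddf_sum linear_sum; apply: eq_bigr => I _.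
  by rewrite [LHS]mevalZ linearZ; apply: mulrC.
have sumE x : \sum_i (f i).@[pt x] *: b`_i = ext_eval F x.
  by rewrite [RHS](coord_vbasis (memvf _)); apply: eq_bigr => i _; rewrite fE.
exists f; split.
- by move=> i; apply: rpred_sum => I _; apply: dhomogZ.
(* A zero of a common divisor [h] off the origin would be a zero of the whole vector
   [ext_eval F]. *)
- move=> h hf; apply: nonvanishing_unit => // z [a za].
  have [x xz] := pt_surj z; rewrite -(meval_eq _ xz).
  have x0 : x != 0 by apply/pt_neq0; exists a; rewrite xz.
  apply: contraNneq (F0 x0) => hx; rewrite -sumE big1 // => i _.
  by have [q ->] := hf i; rewrite mevalM hx mulr0 scale0r.
- by move=> L x xL x0; rewrite (phiE L x xL x0) -sumE.
Qed.

End ExtDegree.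

(** * The operators given by powers of elements of the Lie algebra *)

Section Operators.
Variables (k : fieldType) (p : nat) (g : restrictedLieAlgebra k p).
Implicit Types (M N : U0module g) (x : g).

Lemma xpowS M x j z : xpow M x j.+1 z = uact M (U0_gen x) (xpow M x j z).
Proof. by rewrite /xpow iterS comp_lfunE. Qed.

Lemma uact_gen_linear M c x y :
  uact M (U0_gen (c *: x + y)) = c *: uact M (U0_gen x) + uact M (U0_gen y).
Proof. by rewrite U0_gen_linear uact_linear. Qed.

Lemma uact_gen0 M : uact M (U0_gen (0 : g)) = 0.
Proof.
have := uact_gen_linear M (-1) 0 0.
by rewrite scaler0 addr0 scaleN1r addNr.
Qed.

Lemma uact_genZ M c x : uact M (U0_gen (c *: x)) = c *: uact M (U0_gen x).
Proof. by rewrite -[c *: x]addr0 uact_gen_linear uact_gen0 addr0. Qed.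

Lemma xpowZ M c x j z : xpow M (c *: x) j z = c ^+ j *: xpow M x j z.
Proof.
elim: j => [|j IHj]; first by rewrite expr0 scale1r.
by rewrite !xpowS IHj linearZ /= uact_genZ scale_lfunE scalerA exprSr.
Qed.

Lemma xpow0 M j z : (0 < j)%N -> xpow M (0 : g) j z = 0.
Proof. by case: j => // j _; rewrite xpowS uact_gen0 zero_lfunE. Qed.

Lemma limg_xpowZ M c x j : c != 0 -> limg (xpow M (c *: x) j) = limg (xpow M x j).
Proof.
move=> c0; have cj0 : c ^+ j != 0 by rewrite expf_neq0.
apply/vspaceP => y; apply/memv_imgP/memv_imgP => -[z _ ->].
  by exists (c ^+ j *: z); rewrite ?memvf // linearZ xpowZ.
by exists (c ^- j *: z); rewrite ?memvf // linearZ /= xpowZ scalerA mulVf ?scale1r.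
Qed.

Lemma xpow_equivariant M N (f : 'Hom(M, N)) x j z : U0_equivariant f ->
  f (xpow M x j z) = xpow N x j (f z).
Proof.
by move=> ef; elim: j => [|j IHj]; rewrite ?xpowS ?ef ?IHj // !id_lfunE.
Qed.

End Operators.

Section ConstantRank.
Variables (k : closedFieldType) (p : nat) (g : restrictedLieAlgebra k p).
Variables (V : {vspace g}).
Hypothesis hV : forall x : g, x \in V <-> ppow x = 0.
Hypothesis dimV : (2 <= \dim V)%N.
Variables (j : nat) (M : U0module g).
Hypothesis j0 : (0 < j)%N.
Hypothesis cM : constant_rank M j.
Local Notation A := (subvs_of V).
Local Notation S := {mpoly k[\dim {:A}]}.
Local Notation op x := (xpow M (vsval x) j).

Lemma dim_subvs : (2 <= \dim {:A})%N.
Proof. by rewrite dimvf. Qed.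

Lemma vsval_neq0 (x : A) : x != 0 -> vsval x != 0.
Proof. by apply: contraNneq => e; apply/eqP/val_inj; rewrite /= e. Qed.

Lemma xrank_constant (x : A) : x != 0 -> xrank M (vsval x) j = generic_rank M j.
Proof.
move=> x0; have px : ppow (vsval x) = 0 by apply/hV/subvsP.
apply/eqP; rewrite eqn_leq; apply/andP; split.
  have lt : (xrank M (vsval x) j < (\dim {:M}).+1)%N by rewrite ltnS dimvS ?subvf.
  apply: (bigmax_sup (Ordinal lt)) => //.
  by apply/asboolP; exists (vsval x).
apply/bigmax_leqP => d /asboolP[y py <-].
(* The maximum defining [generic_rank] also runs over 0, whose rank is 0 because [j] is positive. *)
have [->|y0] := eqVneq y 0.
  rewrite [xrank _ 0 _](_ : _ = 0%N) //; apply/eqP; rewrite dimv_eq0 -subv0.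
  apply/subvP => z /memv_imgP[t _ ->].
  by rewrite xpow0 // mem0v.
by rewrite (cM py y0 px (vsval_neq0 x0)).
Qed.

Lemma hpolyfun_xpow z r i :
  hpolyfun r (fun x : A => coord (vbasis {:M}) i (xpow M (vsval x) r z)).
Proof.
elim: r i => [|r IHr] i.
  by apply: eq_hpolyfun (hpolyfun_cst A _) => x; rewrite /xpow /=.
(* An entry of the matrix of the action of [x], linear in [x]; each further application of [x]
   raises the degree by one. *)
pose X a (x : A) := coord (vbasis {:M}) i (uact M (U0_gen (vsval x)) (vbasis {:M})`_a).
apply: (@eq_hpolyfun _ _ _
  (fun x : A => \sum_a coord (vbasis {:M}) a (xpow M (vsval x) r z) * X a x)).
  move=> x; rewrite xpowS [in RHS](coord_vbasis (memvf (xpow M (vsval x) r z))).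
  by rewrite !linear_sum; apply: eq_bigr => a _; rewrite !linearZ.
rewrite -addn1; apply: hpolyfun_sum => a; apply: hpolyfunM => //.
apply: hpolyfun_linear => c x y.
by rewrite /X linearP /= uact_gen_linear add_lfunE scale_lfunE linearD linearZ.
Qed.

Lemma line_repr_neq0 (L : Proj A) : vpick (val L) != 0.
Proof. by rewrite vpick0 -dimv_eq0 (eqP (valP L)). Qed.

Lemma line_reprP (L : Proj A) (x : A) : x \in val L -> x != 0 ->
  exists2 c, c != 0 & x = c *: vpick (val L).
Proof.
move=> xL x0; have : x \in <[vpick (val L)]>%VS.
  have /eqP -> : <[vpick (val L)]>%VS == val L; last by [].
  by rewrite eqEdim -memvE memv_pick dim_vline line_repr_neq0 (eqP (valP L)).
case/vlineP=> c xE; exists c => //; apply: contraNneq x0 => c0.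
by rewrite xE c0 scale0r.
Qed.

Lemma UMj_full (L : Proj A) : UMj M j L.
Proof. by rewrite /UMj /line_repr xrank_constant ?line_repr_neq0. Qed.

Variables (m : nat) (z : 'I_m -> M).
Hypothesis spanz : forall y, exists u : 'I_m -> k, y = \sum_a u a *: z a.

(** The factorization of minors applied to the images of [op x]: the degree of [F] is
    [jdegree V M j], and [v] carries the complementary degree. The rank enters through an equation
    so that [d] can later be a sum of two ranks. *)
Lemma module_minors d : generic_rank M j = d ->
  exists D (v : {ffun 'I_d -> 'I_m} -> S),
  [/\ (D + jdegree V M j = j * d)%N, forall c, v c \is D.-homog, nonvanishing v &
      forall (x : A) (b : 'I_d -> M), x != 0 ->
        (forall a, b a \in limg (op x)) ->
        (forall y, y \in limg (op x) -> exists u : 'I_d -> k, y = \sum_a u a *: b a) ->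
      exists2 mu : k, mu != 0 & forall (c : {ffun 'I_d -> 'I_m}) (C : 'M_d),
        (forall a, op x (z (c a)) = \sum_l C a l *: b l) ->
        (v c).@[pt x] = mu * \det C].
Proof.
move=> hd; subst d; set d := generic_rank M j.
pose L (x : A) := limg (op x); pose w a (x : A) := op x (z a).
have dimL (x : A) : x != 0 -> \dim (L x) = d by exact: xrank_constant.
have wL (x : A) a : w a x \in L x by rewrite memv_img ?memvf.
have spanL (x : A) y : y \in L x -> exists u : 'I_m -> k, y = \sum_a u a *: w a x.
  case/memv_imgP=> t _ ->; have [u ->] := spanz t; exists u.
  by rewrite linear_sum; apply: eq_bigr => a _; rewrite linearZ.
have polyw a i : hpolyfun j (fun x => coord (vbasis {:M}) i (w a x)).
  exact: hpolyfun_xpow.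
have [e [D [F [v [hF hv De v0 Fv]]]]] :=
  plucker_factorization dim_subvs dimL wL spanL polyw.
exists D, v; split=> //; last first.
  move=> x b x0 bL spb; have [Fx vx] := Fv x x0.
  exact: (minors_of_basis dimL wL x0 v0 Fx vx bL spb).
(* For rank 0 the degree is 0 by convention, and [e] is 0 because [D + e = j * 0]. *)
rewrite -De; congr addn; rewrite /jdegree -/d; case: posnP => [d0|d_gt0].
  by move: De; rewrite d0 muln0 => /eqP; rewrite addn_eq0 => /andP[_ /eqP].
have F0 (x : A) : x != 0 -> ext_eval F x != 0.
  move=> x0; have [[kap kap0 ->] _] := Fv x x0.
  by rewrite scaler_eq0 negb_or kap0 pl_basis_wedge_neq0 ?dimL.
have deg_e : has_degree (fun L : {L : Proj A | UMj M j L} => pl (imj L)) e.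
  apply: (ext_eval_has_degree dim_subvs hF F0) => K x xK x0.
  have [[kap kap0 ->] _] := Fv x x0; rewrite vlineZ //.
  congr (<[wedge (pl_basis _)]>%VS).
  have [c c0 ->] := line_reprP xK x0.
  by rewrite /L linearZ /= limg_xpowZ.
(* Uniqueness of the degree makes the choice in [degree] return [e]. *)
rewrite /degree; apply: xget_unique => // e' deg_e'.
exact: (has_degree_unique dim_subvs UMj_full deg_e' deg_e).
Qed.

End ConstantRank.

(** * Images of powers along a short exact sequence *)

Section Extensions.
Variables (k : closedFieldType) (p : nat) (g : restrictedLieAlgebra k p).
Variables (N E M : U0module g) (i : 'Hom(N, E)) (q : 'Hom(E, M)).
Hypothesis hNEM : short_exact i q.

Lemma short_exact_lift (y : M) : exists t : E, q t = y.
Proof.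
have [_ _ _ _ qf] := hNEM.
have : y \in limg q by rewrite qf memvf.
by case/memv_imgP=> t _ ->; exists t.
Qed.

Lemma short_exact_ker (t : E) : q t = 0 -> exists s : N, t = i s.
Proof.
have [_ _ _ iq _] := hNEM => qt.
have : t \in limg i by rewrite iq memv_ker qt.
by case/memv_imgP=> s _ ->; exists s.
Qed.

Variables (x : g) (j : nat).
Hypothesis rkE : xrank E x j = (xrank M x j + xrank N x j)%N.
Local Notation LE := (limg (xpow E x j)).
Local Notation LM := (limg (xpow M x j)).
Local Notation LN := (limg (xpow N x j)).

Lemma limg_xpow_lift (y : M) : y \in LM -> exists2 t, t \in LE & q t = y.
Proof.
have [_ eq _ _ _] := hNEM.
case/memv_imgP=> y' _ ->; have [t' <-] := short_exact_lift y'.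
by exists (xpow E x j t'); rewrite ?memv_img ?memvf // xpow_equivariant.
Qed.

Lemma limg_xpow_sub (s : N) : s \in LN -> i s \in LE.
Proof.
have [ei _ _ _ _] := hNEM.
by case/memv_imgP=> s' _ ->; rewrite xpow_equivariant // memv_img ?memvf.
Qed.

(* Additivity of the ranks makes 0 -> LN -> LE -> LM -> 0 exact. *)
Lemma limg_xpow_exact (t : E) : t \in LE -> q t = 0 -> exists2 s, s \in LN & t = i s.
Proof.
have [ei eq i0 iq qf] := hNEM => tE qt.
have sub : (i @: LN <= LE :&: lker q)%VS.
  apply/subvP => _ /memv_imgP[s sN ->]; rewrite memv_cap limg_xpow_sub //= -iq.
  by rewrite memv_img ?memvf.
have qLE : (q @: LE)%VS = LM.
  apply/vspaceP => y; apply/memv_imgP/idP => [[_ /memv_imgP[t' _ ->] ->]|yM].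
    by rewrite xpow_equivariant // memv_img ?memvf.
  by have [t' tE' <-] := limg_xpow_lift yM; exists t'.
have dimi : \dim (i @: LN) = \dim LN.
  by apply: limg_dim_eq; rewrite i0 capv0.
(* Dimension count: [q] maps [LE] onto [LM], so its kernel on [LE] has the dimension of [LN], which
   the injective [i] preserves. *)
have : (i @: LN == LE :&: lker q)%VS.
  rewrite eqEdim sub dimi /= -(leq_add2r (\dim (q @: LE))) limg_ker_dim qLE.
  by rewrite [\dim LE]rkE addnC.
move/eqP=> e; have : t \in (i @: LN)%VS by rewrite e memv_cap tE memv_ker qt /=.
by case/memv_imgP=> s sN ->; exists s.
Qed.

End Extensions.

(** * Additivity of the degree *)

Theorem corollary4p3p2 (k : closedFieldType) (p : nat) (hp : p \in [pchar k])
    (g : restrictedLieAlgebra k p) (V : {vspace g})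
    (hV : forall x : g, x \in V <-> ppow x = 0) (dimV : (2 <= \dim V)%N)
    (j : nat) (hj : (1 <= j <= p.-1)%N)
    (N E M : U0module g) (i : 'Hom(N, E)) (q : 'Hom(E, M))
    (hNEM : short_exact i q)
    (cN : constant_rank N j) (cE : constant_rank E j) (cM : constant_rank M j)
    (hrk : generic_rank E j = (generic_rank M j + generic_rank N j)%N) :
  jdegree V E j = (jdegree V M j + jdegree V N j)%N.
Proof.
have j0 : (0 < j)%N by case/andP: hj.
pose zN (a : 'I_(\dim {:N})) : N := (vbasis {:N})`_a.
pose zM (a : 'I_(\dim {:M})) : M := (vbasis {:M})`_a.
have spN y : exists u, y = \sum_a u a *: zN a.
  by exists (fun a => coord (vbasis {:N}) a y); apply/coord_vbasis/memvf.
have spM y : exists u, y = \sum_a u a *: zM a.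
  by exists (fun a => coord (vbasis {:M}) a y); apply/coord_vbasis/memvf.
have /choice[zM' zM'E] := fun a => short_exact_lift hNEM (zM a).
(* The spanning family of [E] adapted to [N]: lifts of the basis of [M], followed by the image of
   the basis of [N]. *)
pose zE (a : 'I_(\dim {:M} + \dim {:N})) : E :=
  match split a with inl a => zM' a | inr a => i (zN a) end.
have zEl a : zE (lshift _ a) = zM' a by rewrite /zE (unsplitK (inl a)).
have zEr a : zE (rshift _ a) = i (zN a) by rewrite /zE (unsplitK (inr a)).
have spE y : exists u, y = \sum_a u a *: zE a.
  have [u uE] := spM (q y).
  have [|s sE] := short_exact_ker hNEM (t := y - \sum_a u a *: zM' a).
    rewrite linearB linear_sum /= uE; apply/eqP; rewrite subr_eq0; apply/eqP.
    by apply: eq_bigr => a _; rewrite linearZ /= zM'E.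
  have [u' u'E] := spN s.
  exists (fun a => match split a with inl a => u a | inr a => u' a end).
  rewrite big_split_ord /=.
  under eq_bigr do rewrite (unsplitK (inl _)) zEl.
  under [X in _ + X]eq_bigr do rewrite (unsplitK (inr _)) zEr.
  rewrite -[LHS](subrK (\sum_a u a *: zM' a)) sE addrC u'E linear_sum; congr (_ + _).
  by apply: eq_bigr => a _; rewrite linearZ.
set dM := generic_rank M j in hrk *; set dN := generic_rank N j in hrk *.
have [DN [vN [DNE hvN vN0 mN]]] := module_minors hV dimV j0 cN spN (erefl dN).
have [DM [vM [DME hvM vM0 mM]]] := module_minors hV dimV j0 cM spM (erefl dM).
have [DE [vE [DEE hvE vE0 mE]]] := module_minors hV dimV j0 cE spE hrk.
(* Only selections with [dM] lifts followed by [dN] vectors from [N] are kept; these give block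
   triangular matrices. *)
pose cc (c : {ffun 'I_dM -> 'I_(\dim {:M})} * {ffun 'I_dN -> 'I_(\dim {:N})}) :
    {ffun 'I_(dM + dN) -> 'I_(\dim {:M} + \dim {:N})} :=
  [ffun a => match split a with
             | inl a => lshift _ (c.1 a) | inr a => rshift _ (c.2 a) end].
have prop (x : subvs_of V) : x != 0 -> exists2 mu : k, mu != 0 &
    forall c, (vE (cc c)).@[pt x] = mu * (vM c.1 * vN c.2).@[pt x].
  move=> x0; set y := vsval x.
  have rkM : xrank M y j = dM := xrank_constant hV j0 cM x0.
  have rkN : xrank N y j = dN := xrank_constant hV j0 cN x0.
  have rkE : xrank E y j = (xrank M y j + xrank N y j)%N.
    by rewrite rkM rkN -hrk; apply: (xrank_constant hV j0 cE x0).
  pose bM : 'I_dM -> M := pl_basis (limg (xpow M y j)).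
  pose bN : 'I_dN -> N := pl_basis (limg (xpow N y j)).
  have bMP a : bM a \in limg (xpow M y j) by apply: pl_basis_mem.
  have bNP a : bN a \in limg (xpow N y j) by apply: pl_basis_mem.
  have spbM t : t \in limg (xpow M y j) -> exists u : 'I_dM -> k, t = \sum_a u a *: bM a.
    exact: pl_basis_span.
  have spbN t : t \in limg (xpow N y j) -> exists u : 'I_dN -> k, t = \sum_a u a *: bN a.
    exact: pl_basis_span.
  have /choice[bM' bM'E] : forall a, exists t, t \in limg (xpow E y j) /\ q t = bM a.
    by move=> a; have [t] := limg_xpow_lift hNEM (bMP a); exists t.
  (* The coefficients of [q t] are reused for [t]; the remainder lies in the kernel of [q], hence
     comes from the image in [N]. *)
  have decomp t (u : 'I_dM -> k) : t \in limg (xpow E y j) -> q t = \sum_a u a *: bM a ->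
      exists u' : 'I_dN -> k, t = \sum_a u a *: bM' a + \sum_a u' a *: i (bN a).
    move=> tE qt.
    have [||s sN sE] := limg_xpow_exact hNEM rkE (t := t - \sum_a u a *: bM' a).
    - by rewrite memvB // memv_suml // => a _; rewrite memvZ //; have [] := bM'E a.
    - rewrite linearB linear_sum /= qt; apply/eqP; rewrite subr_eq0; apply/eqP.
      by apply: eq_bigr => a _; rewrite linearZ /=; have [_ ->] := bM'E a.
    have [u' u'E] := spbN s sN; exists u'.
    rewrite -[LHS](subrK (\sum_a u a *: bM' a)) sE addrC u'E linear_sum; congr (_ + _).
    by apply: eq_bigr => a _; rewrite linearZ.
  pose bE (a : 'I_(dM + dN)) : E :=
    match split a with inl a => bM' a | inr a => i (bN a) end.
  have bEl a : bE (lshift _ a) = bM' a by rewrite /bE (unsplitK (inl a)).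
  have bEr a : bE (rshift _ a) = i (bN a) by rewrite /bE (unsplitK (inr a)).
  have [muM muM0 {}mM] := mM x bM x0 bMP spbM.
  have [muN muN0 {}mN] := mN x bN x0 bNP spbN.
  have [||muE muE0 {}mE] := mE x bE x0.
  - move=> a; rewrite /bE; case: split => b; first by have [] := bM'E b.
    exact: (limg_xpow_sub hNEM (bNP b)).
  - move=> t tE; have [|u uE] := spbM (q t).
      case/memv_imgP: tE => s _ ->; have [_ eq _ _ _] := hNEM.
      by rewrite xpow_equivariant // memv_img ?memvf.
    have [u' ->] := decomp t u tE uE.
    exists (fun a => match split a with inl a => u a | inr a => u' a end).
    rewrite big_split_ord /=; congr (_ + _); apply: eq_bigr => a _.
      by rewrite (unsplitK (inl a)) bEl.
    by rewrite (unsplitK (inr a)) bEr.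
  (* The determinant for [E] is the product of those for [M] and [N], so only the three normalizing
     scalars remain. *)
  exists (muE / (muM * muN)); first by rewrite mulf_neq0 // invr_eq0 mulf_neq0.
  case=> c1 c2 /=; rewrite mevalM.
  have opM a : xpow M y j (zM (c1 a)) \in limg (xpow M y j) by rewrite memv_img ?memvf.
  have opN a : xpow N y j (zN (c2 a)) \in limg (xpow N y j) by rewrite memv_img ?memvf.
  have opE a : xpow E y j (zM' (c1 a)) \in limg (xpow E y j) by rewrite memv_img ?memvf.
  have [ei eq _ _ _] := hNEM.
  have /choice[CM CME] := fun a => spbM _ (opM a).
  have /choice[CN CNE] := fun a => spbN _ (opN a).
  (* [CD] is the off-diagonal block: the part along [N] of the images of the lifts. *)
  have /choice[CD CDE] : forall a, exists u' : 'I_dN -> k, xpow E y j (zM' (c1 a)) =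
      \sum_l CM a l *: bM' l + \sum_l u' l *: i (bN l).
    by move=> a; apply: decomp => //; rewrite xpow_equivariant // zM'E CME.
  pose CMm : 'M_dM := \matrix_(a, l) CM a l.
  pose CNm : 'M_dN := \matrix_(a, l) CN a l.
  pose CDm : 'M_(dM, dN) := \matrix_(a, l) CD a l.
  rewrite (mM c1 CMm); last by move=> a; rewrite CME; apply: eq_bigr => l _; rewrite mxE.
  rewrite (mN c2 CNm); last by move=> a; rewrite CNE; apply: eq_bigr => l _; rewrite mxE.
  rewrite (mE (cc (c1, c2)) (block_mx CMm CDm 0 CNm)).
    by rewrite det_ublock [muM * _ * _]mulrACA [RHS]mulrA divfK // mulf_neq0.
  move=> a; rewrite /cc ffunE /= big_split_ord /=.
  case: (split_ordP a) => b ->; rewrite ?zEl ?zEr.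
    rewrite CDE; congr (_ + _); apply: eq_bigr => l _.
      by rewrite block_mxEul mxE bEl.
    by rewrite block_mxEur mxE bEr.
  rewrite big1 ?add0r; last by move=> l _; rewrite block_mxEdl mxE scale0r.
  rewrite -(xpow_equivariant _ _ _ ei) CNE linear_sum; apply: eq_bigr => l _.
  by rewrite block_mxEdr mxE bEr linearZ.
have vMN0 : nonvanishing (fun c => vM c.1 * vN c.2).
  move=> x x0; have [c1 h1] := vM0 x x0; have [c2 h2] := vN0 x x0.
  by exists (c1, c2); rewrite mevalM mulf_neq0.
(* Restricting [vE] to the indices [cc c] could create common zeros; the comparison with [vM] and
   [vN] excludes this. *)
have vEc0 : nonvanishing (fun c => vE (cc c)).
  apply/nonvanishingP => x x0; have [c hc] := (nonvanishingP _).1 vMN0 x x0.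
  have [mu mu0 muE] := prop x x0.
  by exists c; rewrite muE mulf_neq0.
(* The scalar [mu] depends on the point but not on [c], so it cancels from the cross products. *)
have DD : DE = (DM + DN)%N.
  apply: (nonvanishing_degree (dim_subvs dimV) vEc0 vMN0) => [c|c|t [a ta] c c'].
  - exact: hvE.
  - exact: dhomogM.
  have [x xt] := pt_surj t; rewrite -!(meval_eq _ xt).
  have x0 : x != 0 by apply/pt_neq0; exists a; rewrite xt.
  have [mu _ muE] := prop x x0.
  by rewrite !muE -!mulrA; congr (_ * _); apply: mulrC.
(* The three relations between complementary degrees are combined along
   [j * (dM + dN) = j * dM + j * dN]. *)
apply/eqP; rewrite -(eqn_add2l DE) DEE mulnDr -DME -DNE DD.
by rewrite addnACA.
Qed.
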